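(* Let $(X,T)$ be a minimal topological dynamical system with $T$ a homeomorphism, and let $\phi: X\to X_\infty=X/\mathbf{RP}^{[\infty]}(X)$ be the factor map onto its maximal $\infty$-step nilfactor. Then the following statements are equivalent: (1) $(X,T)$ is strongly $\mathcal{F}_{fip}$-sensitive; (2) $(X,T)$ is block $\mathcal{F}_{ip}$-sensitive; (3) there exists $\delta>0$ such that for every $x\in X$ there exists $y\in X$ with $(x,y)\in\mathbf{RP}^{[\infty]}(X)$ and $d(x,y)\ge\delta$; (4) $\phi$ is not almost one-to-one.
   Context: A topological dynamical system $(X,T)$: compact metric space $(X,d)$, $T$ continuous surjective; minimal means every orbit is dense. For a finite or infinite sequence $(p_i)_{i\in I}$ in $\mathbb{N}$, $FS((p_i)_{i\in I})$ is the set of sums $\sum_{i\in\alpha}p_i$ over finite nonempty $\alpha\subset I$; when $|I|=n$ finite it is a finite IP-set of length $n$. $\mathcal{F}_{fip}$ is the family of subsets of $\mathbb{Z}_+$ containing finite IP-sets of arbitrarily long lengths. For a family $\mathcal{F}$ of subsets of $\mathbb{Z}_+$, $(X,T)$ is strongly $\mathcal{F}$-sensitive if there is $\delta>0$ such that for each nonempty open $U\subset X$ there are $x,y\in U$ with $\{n\in\mathbb{Z}_+: d(T^nx,T^ny)>\delta\}\in\mathcal{F}$. $(X,T)$ is block $\mathcal{F}_{ip}$-sensitive if there is $\delta>0$ such that for each $x\in X$, each neighborhood $U$ of $x$ and each $l\in\mathbb{N}$ there is $y_l\in U$ such that $\{n\in\mathbb{Z}_+: d(T^nx,T^ny_l)>\delta\}$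 contains a finite IP-set of length $l$. For $d\in\mathbb{N}$, $(x,y)\in\mathbf{RP}^{[d]}(X)$ if for every $\delta>0$ there are $x',y'\in X$ and $\mathbf{n}=(n_1,\dots,n_d)\in\mathbb{Z}^d$ with $d(x,x')<\delta$, $d(y,y')<\delta$ and $d(T^{\mathbf{n}\cdot\varepsilon}x',T^{\mathbf{n}\cdot\varepsilon}y')<\delta$ for all $\varepsilon\in\{0,1\}^d\setminus\{(0,\dots,0)\}$, where $\mathbf{n}\cdot\varepsilon=\sum_i\varepsilon_in_i$. $\mathbf{RP}^{[\infty]}(X)=\bigcap_{d\ge1}\mathbf{RP}^{[d]}(X)$, a closed invariant equivalence relation for minimal systems. A factor map $\phi$ is almost one-to-one if $\{x\in X:\phi^{-1}(\phi(x))=\{x\}\}$ is dense in $X$. *)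

(* Defs.v *)
From Stdlib Require Import Reals ZArith Arith Lia Lra.
Open Scope R_scope.

Section Dyn.
Context {X : Type} (d : X -> X -> R).

Definition is_metric : Prop :=
  (forall x y, 0 <= d x y) /\ (forall x y, d x y = 0 <-> x = y) /\
  (forall x y, d x y = d y x) /\ (forall x y z, d x z <= d x y + d y z).

Definition ball (x : X) (e : R) : X -> Prop := fun y => d x y < e.

Definition is_open (U : X -> Prop) : Prop :=
  forall x, U x -> exists e, 0 < e /\ forall y, ball x e y -> U y.

Definition is_nbhd (x : X) (U : X -> Prop) : Prop :=
  exists V, is_open V /\ V x /\ forall y, V y -> U y.

Definition dense (A : X -> Prop) : Prop :=
  forall x e, 0 < e -> exists a, A a /\ d x a < e.

Definition compact_space : Prop :=
  forall (I : Type) (U : I -> X -> Prop), (forall i, is_open (U i)) ->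
    (forall x, exists i, U i x) ->
    exists l : list I, forall x, exists i, List.In i l /\ U i x.

Definition continuous_map (f : X -> X) : Prop :=
  forall x e, 0 < e -> exists r, 0 < r /\ forall y, d x y < r -> d (f x) (f y) < e.

(* integer iterates of T, using its inverse S for negative exponents *)
Definition iterz (T S : X -> X) (z : Z) (x : X) : X :=
  match z with
  | Z0 => x
  | Zpos p => Nat.iter (Pos.to_nat p) T x
  | Zneg p => Nat.iter (Pos.to_nat p) S x
  end.

Definition minimal (T : X -> X) : Prop :=
  forall x, dense (fun y => exists n : nat, y = Nat.iter n T x).

Fixpoint dotz (k : nat) (n : nat -> Z) (eps : nat -> bool) : Z :=
  match k with
  | O => 0%Z
  | S k' => (dotz k' n eps + (if eps k' then n k' else 0))%Z
  end.

Definition RP (T S : X -> X) (k : nat) (x y : X) : Prop :=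
  forall delta, 0 < delta -> exists x' y' (n : nat -> Z),
    d x x' < delta /\ d y y' < delta /\
    forall eps : nat -> bool, (exists i, (i < k)%nat /\ eps i = true) ->
      d (iterz T S (dotz k n eps) x') (iterz T S (dotz k n eps) y') < delta.

Definition RPinf (T S : X -> X) (x y : X) : Prop :=
  forall k, (1 <= k)%nat -> RP T S k x y.

(* the factor map X -> X/RP^[oo](X), sending x to its RP^[oo]-class *)
Definition phi_inf (T S : X -> X) (x : X) : X -> Prop := RPinf T S x.

Definition almost_one_to_one {Y : Type} (phi : X -> Y) : Prop :=
  dense (fun x => forall x', phi x' = phi x -> x' = x).

End Dyn.

Fixpoint subsum (k : nat) (p : nat -> nat) (alpha : nat -> bool) : nat :=
  match k with
  | O => O
  | S k' => (subsum k' p alpha + (if alpha k' then p k' else O))%nat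
  end.

Definition contains_fip (A : nat -> Prop) (l : nat) : Prop :=
  exists p : nat -> nat, (forall i, (i < l)%nat -> (1 <= p i)%nat) /\
    forall alpha : nat -> bool, (exists i, (i < l)%nat /\ alpha i = true) ->
      A (subsum l p alpha).

Definition F_fip (A : nat -> Prop) : Prop := forall l, contains_fip A l.

Definition strongly_sensitive {X : Type} (d : X -> X -> R) (T : X -> X)
    (F : (nat -> Prop) -> Prop) : Prop :=
  exists delta, 0 < delta /\ forall U, is_open d U -> (exists u, U u) ->
    exists x y, U x /\ U y /\ F (fun n => d (Nat.iter n T x) (Nat.iter n T y) > delta).

Definition block_ip_sensitive {X : Type} (d : X -> X -> R) (T : X -> X) : Prop :=
  exists delta, 0 < delta /\ forall x U, is_nbhd d x U -> forall l, (1 <= l)%nat ->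
    exists y, U y /\ contains_fip (fun n => d (Nat.iter n T x) (Nat.iter n T y) > delta) l.

(* Main.v *)
(* Write [act k p a x] for the limit, along an ultrafilter [p] on Z^k, of T^(n.a) x (a in {0,1}^k),
   and [cubeQ k] for the closure of the cubes (T^(n.a) z)_a.

   Let [u] be a minimal idempotent of beta Z with u-lim T^n y = y. The image of [u] under the
   product of the coordinate axes is an idempotent whose projection along every a <> 0 is again
   [u], and this forces the constant cube [y] to be a minimal point of the face group. By induction
   on [k], every cube of [cubeQ k] based at [x] has the constant cube [x] in its face-orbit closure.
   Hence (x,y) is in RP^[oo] iff for each neighbourhood U of y the return times from x to U contain
   finite IP-sets of every length; transitivity of RP^[oo] follows at once.

   By Baire, the cubes based at a generic [x] all lie in the face-orbit closure of the constant cube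
   [x], so that any vertex [x] of a cube may be replaced by any [y] with (x,y) in RP^[oo]. If
   d(x,y) >= delta, the cube with [y] at the nonzero vertices of its lower face and [x] elsewhere
   yields points near [x] that are separated along a finite IP-set. Conversely, Folkman's theorem
   (an idempotent for the union of finite sets) turns local separation into separation from any
   given point, and, in the limit, into RP^[oo]-pairs at distance at least a constant. *)

Require Import Defs.
From Stdlib Require Import Reals ZArith Arith Lia Lra List.
From Stdlib Require Import Classical ClassicalEpsilon IndefiniteDescription.
From Stdlib Require Import FunctionalExtensionality PropExtensionality ProofIrrelevance.
From mathcomp Require classical_sets filter.
Set Bullet Behavior "Strict Subproofs".
Open Scope R_scope.

(** * Ultrafilters and idempotents *)

Lemma set_ext {M : Type} (A B : M -> Prop) : (forall a, A a <-> B a) -> A = B.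
Proof.
  intros H; apply functional_extensionality; intros a.
  apply propositional_extensionality; apply H.
Qed.

(** Ultrafilters: [mem_not] packs properness and maximality into one equivalence. *)
Record beta (M : Type) := Beta {
  mem : (M -> Prop) -> Prop;
  mem_and : forall A B, mem A -> mem B -> mem (fun a => A a /\ B a);
  mem_mono : forall A B : M -> Prop, mem A -> (forall a, A a -> B a) -> mem B;
  mem_not : forall A, mem (fun a => ~ A a) <-> ~ mem A }.
Arguments mem {M}. Arguments mem_and {M}. Arguments mem_mono {M}. Arguments mem_not {M}.

Section Ultra.
Context {M : Type}.
Implicit Types (p q r : beta M) (A B : M -> Prop).

Lemma beta_ext p q : (forall A, mem p A -> mem q A) -> p = q.
Proof.
  intros H.
  assert (E : mem p = mem q).
  { apply set_ext; intros A; split; [apply H|intros HA].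
    apply NNPP; intros N. apply (mem_not p) in N. apply H in N.
    apply (mem_not q) in N; auto. }
  destruct p as [m h1 h2 h3], q as [m' h1' h2' h3']; simpl in *; subst m'.
  f_equal; apply proof_irrelevance.
Qed.

Lemma mem_all p A : (forall a, A a) -> mem p A.
Proof.
  intros H; apply NNPP; intros N. apply (mem_not p) in N.
  apply (mem_not p A); [exact N|]. apply (mem_mono p _ _ N); auto.
Qed.

Lemma mem_ex p A : mem p A -> exists a, A a.
Proof.
  intros H; apply NNPP; intros N.
  apply (mem_not p A); [|exact H]. apply (mem_all p); intros a Ha; apply N; eauto.
Qed.

Lemma mem_or p A B : mem p (fun a => A a \/ B a) -> mem p A \/ mem p B.
Proof.
  intros H. destruct (classic (mem p A)) as [|N]; [now left|right].
  apply (mem_not p) in N. apply (mem_mono p _ _ (mem_and p _ _ H N)). tauto.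
Qed.

Lemma mem_const p (P : Prop) : mem p (fun _ => P) <-> P.
Proof.
  split; [intros H; now destruct (mem_ex _ _ H)|intros H; now apply mem_all].
Qed.

Lemma ultra_extend (F : (M -> Prop) -> Prop) :
  (exists A, F A) ->
  (forall A B, F A -> F B -> exists C, F C /\ forall a, C a -> A a /\ B a) ->
  (forall A, F A -> exists a, A a) ->
  exists p, forall A, F A -> mem p A.
Proof.
  intros [A0 H0] H1 H2.
  set (G := fun B : M -> Prop => exists A, F A /\ forall a, A a -> B a).
  assert (PG : @filter.ProperFilter M G).
  { constructor.
    - intros [A [HA HA']]. destruct (H2 A HA) as [a Ha]. exact (HA' a Ha).
    - constructor.
      + exists A0; split; [exact H0|intros; exact I].
      + intros A B [A' [HA HA']] [B' [HB HB']].
        destruct (H1 A' B' HA HB) as [C [HC HC']].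
        exists C; split; [exact HC|]. intros a Ha; destruct (HC' a Ha);
        split; [apply HA'|apply HB']; assumption.
      + intros A B HAB [A' [HA HA']]. exists A'; split; [exact HA|].
        intros a Ha; exact (HAB a (HA' a Ha)). }
  destruct (filter.ultraFilterLemma PG) as [U [HU HGU]].
  pose proof (filter.ultra_proper (UltraFilter := HU)) as PU.
  pose proof (filter.filter_filter (ProperFilter := PU)) as FU.
  unshelve eexists (Beta M U _ _ _).
  - intros A B HA HB. exact (filter.filterI HA HB).
  - intros A B HA HAB. exact (filter.filterS HAB HA).
  - intros A; split.
    + intros N HA. apply (@filter.filter_not_empty M U PU).
      refine (filter.filterS _ (filter.filterI HA N)). intros a [h1 h2]; exact (h2 h1).
    + intros N. destruct (filter.in_ultra_setVsetC A HU) as [h|h]; [contradiction|exact h].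
  - intros A HA; simpl. apply HGU. exists A; auto.
Qed.

(** Closedness in the Stone topology, whose basic clopen sets collect the ultrafilters containing a
    fixed [A]: [K] contains its adherent points. *)
Definition closedb (K : beta M -> Prop) : Prop :=
  forall p, (forall A, mem p A -> exists q, K q /\ mem q A) -> K p.

Lemma closedb_basic A : closedb (fun p => mem p A).
Proof.
  intros p H. apply NNPP; intros N. apply (mem_not p) in N.
  destruct (H _ N) as [q [h1 h2]]. now apply (mem_not q A).
Qed.

Lemma closedb_and K K' : closedb K -> closedb K' -> closedb (fun p => K p /\ K' p).
Proof.
  intros H H' p Hp; split; [apply H|apply H']; intros A HA;
  destruct (Hp A HA) as [q [[h1 h2] h3]]; eauto.
Qed.

Lemma closedb_forall (I : Type) (K : I -> beta M -> Prop) :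
  (forall i, closedb (K i)) -> closedb (fun p => forall i, K i p).
Proof.
  intros H p Hp i. apply H. intros A HA. destruct (Hp A HA) as [q [h1 h2]]; eauto.
Qed.

(** Compactness of the space of ultrafilters. The sets lying in all members of some [K i] form a
    filter base, and an ultrafilter extending it is adherent to every [K i]. *)
Lemma closedb_directed (I : Type) (K : I -> beta M -> Prop) :
  inhabited I -> (forall i, closedb (K i)) -> (forall i, exists p, K i p) ->
  (forall i j, exists k, forall p, K k p -> K i p /\ K j p) ->
  exists p, forall i, K i p.
Proof.
  intros [i0] Hc Hn Hd.
  destruct (ultra_extend (fun A => exists i, forall q, K i q -> mem q A)) as [p Hp].
  - exists (fun _ => True), i0. intros q _; now apply mem_all.
  - intros A B [i Hi] [j Hj]. destruct (Hd i j) as [k Hk].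
    exists (fun a => A a /\ B a); split; [|auto]. exists k; intros q Hq.
    apply Hk in Hq. now apply mem_and; [apply Hi|apply Hj].
  - intros A [i Hi]. destruct (Hn i) as [q Hq]. exact (mem_ex q A (Hi q Hq)).
  - exists p; intros i. apply (Hc i); intros A HA. apply NNPP; intros N.
    apply (mem_not p A); [|exact HA]. apply Hp. exists i; intros q Hq.
    apply (mem_not q); intros hq; apply N; eauto.
Qed.

Lemma closedb_minimal (K0 : beta M -> Prop) (Pr : (beta M -> Prop) -> Prop) :
  closedb K0 -> (exists p, K0 p) -> Pr K0 ->
  (forall (I : Type) (K : I -> beta M -> Prop), inhabited I ->
     (forall i, Pr (K i)) -> Pr (fun p => forall i, K i p)) ->
  exists K, closedb K /\ (exists p, K p) /\ Pr K /\ (forall p, K p -> K0 p) /\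
    forall K', closedb K' -> (exists p, K' p) -> Pr K' -> (forall p, K' p -> K p) ->
      forall p, K p -> K' p.
Proof.
  intros Hc Hn HP HI.
  (* Zorn's lemma for unions of chains is applied to complements: a maximal [O] leaves a minimal
     [cut O]. *)
  set (cut := fun O p => K0 p /\ ~ O p).
  set (Z := fun O : beta M -> Prop =>
    closedb (cut O) /\ (exists p, cut O p) /\ Pr (cut O)).
  destruct (@classical_sets.Zorn_bigcup (beta M) Z) as [O [[h1 [h2 h3]] HO]].
  - intros F HF Htot.
    destruct (classic (exists O, F O)) as [[O1 HO1]|HN].
    + set (J := {O | F O}).
      assert (E : cut (classical_sets.bigcup F (fun O => O)) =
        fun p => forall i : J, cut (proj1_sig i) p).
      { apply set_ext; intros p; split.
        - intros [h1 h2] [O HOF]; split; [exact h1|]. intros h; apply h2. now exists O.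
        - intros h; split; [exact (proj1 (h (exist _ O1 HO1)))|].
          intros [O HOF hp]. exact (proj2 (h (exist _ O HOF)) hp). }
      unfold Z; rewrite E.
      assert (HJ : forall i : J, Z (proj1_sig i)) by (intros [O HOF]; now apply HF).
      split; [|split].
      * apply closedb_forall; intros i; apply (HJ i).
      * apply closedb_directed; [exact (inhabits (exist _ O1 HO1)) | intros i; apply (HJ i)
          | intros i; apply (HJ i)|].
        intros [A HA] [B HB]. destruct (Htot A B HA HB) as [h|h].
        -- exists (exist _ B HB); simpl; intros p [h1 h2]; repeat split; auto.
        -- exists (exist _ A HA); simpl; intros p [h1 h2]; repeat split; auto.
      * apply HI; [exact (inhabits (exist _ O1 HO1))|intros i; apply (HJ i)].
    + assert (E : cut (classical_sets.bigcup F (fun O => O)) = K0).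
      { apply set_ext; intros p; split; [intros [h _]; exact h|].
        intros h; split; [exact h|]. intros [O HOF _]. apply HN; eauto. }
      unfold Z; rewrite E; auto.
  - exists (cut O); split; [exact h1|split; [exact h2|split; [exact h3|split]]].
    { intros p [h _]; exact h. }
    intros K' Hc' Hn' HP' Hs p Hp. apply NNPP; intros N.
    apply (HO (fun p => ~ K' p)).
    + split; [|intros hs; exact (proj2 Hp (hs p N))].
      intros q hq hk. exact (proj2 (Hs q hk) hq).
    + assert (E : cut (fun p => ~ K' p) = K').
      { apply set_ext; intros q; split; [intros [_ h]; now apply NNPP|].
        intros h; split; [exact (proj1 (Hs q h))|tauto]. }
      unfold Z; rewrite E; auto.
Qed.

End Ultra.

Definition pushb {M N : Type} (f : M -> N) (p : beta M) : beta N.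
Proof.
  refine (Beta N (fun B => mem p (fun a => B (f a))) _ _ _).
  - intros A B; apply mem_and.
  - intros A B H HAB; apply (mem_mono p _ _ H); auto.
  - intros A; apply mem_not.
Defined.

Definition principal {M : Type} (a : M) : beta M.
Proof.
  refine (Beta M (fun A => A a) _ _ _); auto. intros A; tauto.
Defined.

(** Convolution, with the order of quantifiers that makes multiplication by a fixed right factor
    continuous. *)
Definition mulb {M : Type} (op : M -> M -> M) (p q : beta M) : beta M.
Proof.
  refine (Beta M (fun A => mem p (fun a => mem q (fun b => A (op a b)))) _ _ _).
  - intros A B HA HB. apply (mem_mono p _ _ (mem_and p _ _ HA HB)).
    intros a [h1 h2]; exact (mem_and q _ _ h1 h2).
  - intros A B HA HAB. apply (mem_mono p _ _ HA). intros a h.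
    apply (mem_mono q _ _ h); auto.
  - intros A. rewrite <- mem_not. split; intros H; apply (mem_mono p _ _ H);
    intros a; apply mem_not.
Defined.

Lemma pushb_mulb {M N : Type} (op : M -> M -> M) (op' : N -> N -> N) (f : M -> N) p q :
  (forall a b, f (op a b) = op' (f a) (f b)) ->
  pushb f (mulb op p q) = mulb op' (pushb f p) (pushb f q).
Proof.
  intros H; apply beta_ext; intros A HA; simpl in *.
  apply (mem_mono p _ _ HA); intros a h. apply (mem_mono q _ _ h).
  intros b; now rewrite H.
Qed.

(** * The compact right-topological semigroup of ultrafilters *)

Section Semigroup.
Context {M : Type} (op : M -> M -> M)
  (assoc : forall a b c, op a (op b c) = op (op a b) c).
Implicit Types (p q r : beta M) (K : beta M -> Prop).
Local Infix "**" := (mulb op) (at level 40, left associativity).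

Lemma mulbA p q r : p ** (q ** r) = p ** q ** r.
Proof.
  apply beta_ext; intros A HA; simpl in *.
  apply (mem_mono p _ _ HA); intros a h; apply (mem_mono q _ _ h); intros b h'.
  apply (mem_mono r _ _ h'); intros c; now rewrite assoc.
Qed.

Lemma closedb_preimage_mul p A : closedb (fun k => mem (k ** p) A).
Proof. apply (closedb_basic (fun a => mem p (fun b => A (op a b)))). Qed.

Lemma closedb_mul_eq p q : closedb (fun k => k ** p = q).
Proof.
  assert (E : (fun k => k ** p = q) =
    fun k => forall i : {A | mem q A}, mem (k ** p) (proj1_sig i)).
  { apply set_ext; intros k; split.
    - intros <- [A HA]; exact HA.
    - intros h; symmetry; apply beta_ext; intros A HA. exact (h (exist _ A HA)). }
  rewrite E; apply closedb_forall; intros i; apply closedb_preimage_mul.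
Qed.

(** For [r] adherent to the image, the closed sets of those [k] in [K] with [A] in [k ** p], as [A]
    runs through [r], are nonempty and directed; compactness gives a common point. *)
Lemma closedb_image_mul K p : closedb K -> closedb (fun r => exists k, K k /\ k ** p = r).
Proof.
  intros Hc r Hr.
  destruct (closedb_directed {A | mem r A} (fun i k => K k /\ mem (k ** p) (proj1_sig i)))
    as [k Hk].
  - exact (inhabits (exist _ (fun _ => True) (mem_all r _ (fun _ => I)))).
  - intros i; apply closedb_and; [exact Hc|apply closedb_preimage_mul].
  - intros [A HA]; destruct (Hr A HA) as [q [[k [h1 h2]] h3]]; subst q; eauto.
  - intros [A HA] [B HB]. exists (exist _ _ (mem_and r _ _ HA HB)); simpl.
    intros k [h1 h2]. change (mem (k ** p) (fun a => A a /\ B a)) in h2.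
    split; split; auto; apply (mem_mono (k ** p) _ _ h2); tauto.
  - exists k; split.
    + exact (proj1 (Hk (exist _ (fun _ => True) (mem_all r _ (fun _ => I))))).
    + symmetry; apply beta_ext; intros A HA. exact (proj2 (Hk (exist _ A HA))).
Qed.

(** Ellis-Numakura lemma. In a minimal closed subsemigroup [L] containing [p], the subsemigroup
    [L ** p] is all of [L]. Hence the [k] with [k ** p = p] form a nonempty closed subsemigroup,
    again all of [L], and [p] is one of them. *)
Lemma ellis K : closedb K -> (exists p, K p) -> (forall p q, K p -> K q -> K (p ** q)) ->
  exists p, K p /\ p ** p = p.
Proof.
  intros Hc Hn Hs.
  destruct (closedb_minimal K (fun K => forall p q, K p -> K q -> K (p ** q)) Hc Hn Hs)
    as [L [Lc [[p Lp] [Ls [LK Lm]]]]].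
  { intros I K' _ H p q Hp Hq i. apply H; auto. }
  exists p; split; [auto|].
  assert (H1 : exists k, L k /\ k ** p = p).
  { apply (Lm (fun r => exists k, L k /\ k ** p = r)); auto.
    - now apply closedb_image_mul.
    - exists (p ** p), p; auto.
    - intros r s [k [h1 <-]] [l [h2 <-]]. exists (k ** p ** l); split; [auto|].
      now rewrite !mulbA.
    - intros r [k [h1 <-]]; auto. }
  apply (Lm (fun k => L k /\ k ** p = p)); auto.
  - apply closedb_and; [exact Lc|apply closedb_mul_eq].
  - intros k l [h1 h2] [h3 h4]; split; [auto|]. now rewrite <- mulbA, h4.
  - tauto.
Qed.

Definition left_ideal K : Prop := forall p q, K q -> K (p ** q).

(** By minimality [L ** v] is all of [L], so [u = k ** v] for some [k], and an idempotent [v] is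
    absorbed on the right. *)
Lemma minimal_left_ideal K : closedb K -> (exists p, K p) -> left_ideal K ->
  exists L, closedb L /\ (exists p, L p) /\ left_ideal L /\ (forall p, L p -> K p) /\
    forall u v, L u -> L v -> v ** v = v -> u ** v = u.
Proof.
  intros Hc Hn Hl.
  destruct (closedb_minimal K left_ideal Hc Hn Hl) as [L [Lc [Ln [Ll [LK Lm]]]]].
  { intros I K' _ H p q Hq i. apply H; auto. }
  exists L; split; [exact Lc|split; [exact Ln|split; [exact Ll|split; [exact LK|]]]].
  intros u v Lu Lv Hv.
  destruct (Lm (fun r => exists k, L k /\ k ** v = r)) with (p := u) as [k [_ <-]]; auto.
  - now apply closedb_image_mul.
  - exists (v ** v), v; auto.
  - intros p q [k [h1 <-]]. exists (p ** k); split; [auto|]. now rewrite mulbA.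
  - intros r [k [h1 <-]]; auto.
  - now rewrite <- mulbA, Hv.
Qed.

End Semigroup.

(** * Bit vectors and cubes of integers *)

(** Vertices of a [k]-cube are encoded as total functions of which only the first [k] bits count.
    For a bit [b], [setv a k b] below is the vertex over [a] in the lower or upper face of the cube
    of dimension [k + 1]. *)
Definition agree (k : nat) (e v : nat -> bool) : Prop := forall i, (i < k)%nat -> e i = v i.

Definition setv {A : Type} (f : nat -> A) (k : nat) (b : A) : nat -> A :=
  fun j => if Nat.eq_dec j k then b else f j.

Lemma setv_eq {A : Type} (f : nat -> A) k b : setv f k b k = b.
Proof. unfold setv; destruct (Nat.eq_dec k k); congruence. Qed.

Lemma setv_neq {A : Type} (f : nat -> A) k b j : j <> k -> setv f k b j = f j.
Proof. unfold setv; destruct (Nat.eq_dec j k); congruence. Qed.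

Lemma agree_setv k e v b : agree k e v -> agree (S k) (setv e k b) (setv v k b).
Proof.
  intros H i Hi. unfold setv; destruct (Nat.eq_dec i k); [reflexivity|apply H; lia].
Qed.

Lemma setv_agree k e b : agree k (setv e k b) e.
Proof. intros i Hi; apply setv_neq; lia. Qed.

Lemma setv_same k e b : e k = b -> agree (S k) (setv e k b) e.
Proof. intros <- i Hi. unfold setv; destruct (Nat.eq_dec i k); congruence. Qed.

(* The condition at [e] involves only the first [k] bits of [e], so that there are at most
   [2 ^ k] of them. *)
Lemma bits_uniform {M : Type} (F : (M -> Prop) -> Prop)
  (Fand : forall A B, F A -> F B -> F (fun a => A a /\ B a))
  (Fmono : forall A B : M -> Prop, F A -> (forall a, A a -> B a) -> F B) k :
  forall P : (nat -> bool) -> M -> Prop,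
  (forall e v a, agree k e v -> P e a -> P v a) ->
  (forall e, F (P e)) -> F (fun a => forall e, P e a).
Proof.
  induction k as [|k IH]; intros P HP HF.
  - apply (Fmono _ _ (HF (fun _ => false))). intros a h e.
    apply (HP (fun _ => false)); [intros i Hi; lia|exact h].
  - apply (Fmono (fun a => forall e, P (setv e k false) a /\ P (setv e k true) a)).
    + apply IH; [|intros e; apply Fand; apply HF].
      intros e v a Hev [h1 h2]; split;
      [apply (HP (setv e k false))|apply (HP (setv e k true))]; auto using agree_setv.
    + intros a h e. apply (HP (setv e k (e k))); [now apply setv_same|].
      destruct (h e); now destruct (e k).
Qed.

Lemma mem_bits {M : Type} (p : beta M) k (P : (nat -> bool) -> M -> Prop) :
  (forall e v a, agree k e v -> P e a -> P v a) ->
  (forall e, mem p (P e)) -> mem p (fun a => forall e, P e a).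
Proof. apply bits_uniform; [apply mem_and|apply mem_mono]. Qed.

Lemma dotz_ext k m n e v : (forall i, (i < k)%nat -> m i = n i) -> agree k e v ->
  dotz k m e = dotz k n v.
Proof.
  induction k as [|k IH]; intros H H'; simpl; [reflexivity|].
  rewrite IH, (H k), (H' k); auto. intros i Hi; apply H'; lia.
Qed.

Lemma dotz_agree k n e v : agree k e v -> dotz k n e = dotz k n v.
Proof. now apply dotz_ext. Qed.

Definition addv (m n : nat -> Z) : nat -> Z := fun i => (m i + n i)%Z.

Lemma addv_assoc a b c : addv a (addv b c) = addv (addv a b) c.
Proof. apply functional_extensionality; intros i; unfold addv; lia. Qed.

Lemma dotz_addv k m n e : dotz k (addv m n) e = (dotz k m e + dotz k n e)%Z.
Proof. induction k; simpl; [reflexivity|]. rewrite IHk; unfold addv; destruct (e k); lia. Qed.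

Definition nonzero (k : nat) (e : nat -> bool) : Prop := exists i, (i < k)%nat /\ e i = true.

Lemma dotz_zero k n e : ~ nonzero k e -> dotz k n e = 0%Z.
Proof.
  induction k as [|k IH]; intros H; simpl; [reflexivity|].
  rewrite IH; [|intros [i [h1 h2]]; apply H; exists i; auto].
  destruct (e k) eqn:E; [|reflexivity]. exfalso; apply H; exists k; auto.
Qed.

Lemma nonzero_agree k e v : agree k e v -> nonzero k e -> nonzero k v.
Proof. intros H [i [h1 h2]]; exists i; split; [exact h1|]. now rewrite <- (H i h1). Qed.

Lemma dotz_setv k n b e : dotz k (setv n k b) e = dotz k n e.
Proof. apply dotz_ext; [intros i Hi; apply setv_neq; lia|now intros i _]. Qed.

Lemma dotz_0 k e : dotz k (fun _ => 0%Z) e = 0%Z.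
Proof. induction k; simpl; [reflexivity|]. rewrite IHk; now destruct (e k). Qed.

Definition axis (j : nat) (t : Z) : nat -> Z := setv (fun _ => 0%Z) j t.

Lemma dotz_axis k j t e : (j < k)%nat -> dotz k (axis j t) e = if e j then t else 0%Z.
Proof.
  induction k as [|k IH]; intros Hj; [lia|]. simpl.
  destruct (Nat.eq_dec j k) as [->|N].
  - unfold axis at 1; rewrite dotz_setv. unfold axis; rewrite setv_eq.
    rewrite dotz_0; now destruct (e k).
  - rewrite IH by lia. unfold axis; rewrite setv_neq by lia. destruct (e k), (e j); lia.
Qed.

(** * Limits along ultrafilters and return to a constant cube *)

Section Dynamics.
Context {X : Type} (d : X -> X -> R) (T Ti : X -> X)
  (Hne : inhabited X) (Hd : is_metric d) (Hcpt : compact_space d)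
  (HT : continuous_map d T) (HS : continuous_map d Ti)
  (HST : forall x, Ti (T x) = x) (HTS : forall x, T (Ti x) = x)
  (Hmin : minimal d T).

Lemma dist_pos x y : 0 <= d x y. Proof. apply Hd. Qed.
Lemma dist_self x : d x x = 0. Proof. now apply Hd. Qed.
Lemma dist_sym x y : d x y = d y x. Proof. apply Hd. Qed.
Lemma dist_tri x y z : d x z <= d x y + d y z. Proof. apply Hd. Qed.
Lemma dist_eq x y : (forall e, 0 < e -> d x y < e) -> x = y.
Proof.
  intros H. apply Hd. pose proof (dist_pos x y).
  destruct (Rle_lt_or_eq_dec _ _ H0) as [h|h]; [|auto].
  specialize (H _ h); lra.
Qed.

Lemma ball_open x e : is_open d (ball d x e).
Proof.
  intros y Hy. unfold ball in *. exists (e - d x y); split; [lra|].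
  intros z Hz. pose proof (dist_tri x y z); lra.
Qed.

Definition tends {M : Type} (p : beta M) (f : M -> X) (z : X) : Prop :=
  forall e, 0 < e -> mem p (fun a => d (f a) z < e).

(** If no point were a limit, each would have a ball whose preimage is not in [p]; finitely many
    such balls cover [X], and an ultrafilter has to choose one of them. *)
Lemma tends_ex {M : Type} (p : beta M) (f : M -> X) : exists z, tends p f z.
Proof.
  apply NNPP; intros N.
  assert (H : forall x, exists e, 0 < e /\ ~ mem p (fun a => d (f a) x < e)).
  { intros x; apply NNPP; intros N'. apply N; exists x; intros e He.
    apply NNPP; intros h; apply N'; eauto. }
  destruct (Hcpt {xe : X * R | ~ mem p (fun a => d (f a) (fst xe) < snd xe)}
    (fun i => ball d (fst (proj1_sig i)) (snd (proj1_sig i)))) as [l Hl].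
  - intros i; apply ball_open.
  - intros x; destruct (H x) as [e [He Hp]]. exists (exist _ (x, e) Hp); simpl.
    unfold ball; rewrite dist_self; exact He.
  - assert (Hm : mem p (fun a => exists i, In i l /\
      ball d (fst (proj1_sig i)) (snd (proj1_sig i)) (f a))) by (apply mem_all; auto).
    clear Hl; induction l as [|[[x e] Hx] l IH].
    + destruct (mem_ex _ _ Hm) as [a [i [[] _]]].
    + apply IH. assert (Hm' : mem p (fun a => d (f a) x < e \/
        exists i, In i l /\ ball d (fst (proj1_sig i)) (snd (proj1_sig i)) (f a))).
      { apply (mem_mono p _ _ Hm); intros a [i [[<-|Hi] h]]; [left|right; eauto].
        unfold ball in h; simpl in h; now rewrite dist_sym. }
      destruct (mem_or _ _ _ Hm') as [h|h]; [contradiction|exact h].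
Qed.

Definition plim {M : Type} (p : beta M) (f : M -> X) : X := epsilon Hne (tends p f).

Lemma tends_plim {M : Type} (p : beta M) (f : M -> X) : tends p f (plim p f).
Proof. unfold plim; apply epsilon_spec; apply tends_ex. Qed.

Lemma plim_eq {M : Type} (p : beta M) (f : M -> X) z : tends p f z -> plim p f = z.
Proof.
  intros H; apply dist_eq; intros e He.
  destruct (mem_ex _ _ (mem_and p _ _ (H (e/2) ltac:(lra)) (tends_plim p f (e/2) ltac:(lra))))
    as [a [h1 h2]].
  pose proof (dist_tri (plim p f) (f a) z). rewrite (dist_sym (plim p f) (f a)) in H0; lra.
Qed.

Lemma plim_ext {M : Type} (p : beta M) (f g : M -> X) :
  (forall a, f a = g a) -> plim p f = plim p g.
Proof. intros H; f_equal; apply functional_extensionality; exact H. Qed.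

Lemma plim_const {M : Type} (p : beta M) z : plim p (fun _ => z) = z.
Proof. apply plim_eq; intros e He. apply mem_const; now rewrite dist_self. Qed.

Lemma plim_pushb {M N : Type} (g : M -> N) (p : beta M) (f : N -> X) :
  plim (pushb g p) f = plim p (fun a => f (g a)).
Proof. apply plim_eq; intros e He; apply (tends_plim p (fun a => f (g a)) e He). Qed.

Lemma plim_continuous {M : Type} (p : beta M) (f : M -> X) h :
  continuous_map d h -> plim p (fun a => h (f a)) = h (plim p f).
Proof.
  intros Hh; apply plim_eq; intros e He. destruct (Hh (plim p f) e He) as [r [Hr H]].
  apply (mem_mono p _ _ (tends_plim p f r Hr)); intros a Ha.
  rewrite dist_sym; apply H; now rewrite dist_sym.
Qed.

Lemma plim_mulb {M : Type} (op : M -> M -> M) p q (f : M -> X) :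
  plim (mulb op p q) f = plim p (fun a => plim q (fun b => f (op a b))).
Proof.
  apply plim_eq; intros e He; simpl.
  apply (mem_mono p _ _ (tends_plim p (fun a => plim q (fun b => f (op a b))) (e/2)
    ltac:(lra))).
  intros a Ha. apply (mem_mono q _ _ (tends_plim q (fun b => f (op a b)) (e/2) ltac:(lra))).
  intros b Hb. eapply Rle_lt_trans.
  { apply (dist_tri _ (plim q (fun b => f (op a b)))). }
  cbv beta in *; lra.
Qed.

Lemma plim_dist_ge {M : Type} (p : beta M) (f g : M -> X) c :
  mem p (fun a => d (f a) (g a) >= c) -> d (plim p f) (plim p g) >= c.
Proof.
  intros H. destruct (Rlt_le_dec (d (plim p f) (plim p g)) c) as [h|h]; [|lra].
  set (e := (c - d (plim p f) (plim p g)) / 2).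
  destruct (mem_ex _ _ (mem_and p _ _ H (mem_and p _ _ (tends_plim p f e ltac:(unfold e; lra))
    (tends_plim p g e ltac:(unfold e; lra))))) as [a [h1 [h2 h3]]].
  pose proof (dist_tri (f a) (plim p f) (g a)).
  pose proof (dist_tri (plim p f) (plim p g) (g a)).
  rewrite (dist_sym (plim p g) (g a)) in H1. unfold e in *; lra.
Qed.

(** * Integer iterates and recurrence *)

Notation it := (iterz T Ti).

Lemma it_nat n x : it (Z.of_nat n) x = Nat.iter n T x.
Proof.
  destruct n; [reflexivity|]. cbn [iterz Z.of_nat].
  now rewrite SuccNat2Pos.id_succ.
Qed.

Lemma it_opp_nat n x : it (- Z.of_nat n) x = Nat.iter n Ti x.
Proof.
  destruct n; [reflexivity|]. cbn [iterz Z.of_nat Z.opp].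
  now rewrite SuccNat2Pos.id_succ.
Qed.

Lemma it_succ z x : it (Z.succ z) x = T (it z x).
Proof.
  destruct (Z_le_gt_dec 0 z) as [h|h].
  - rewrite <- (Z2Nat.id z h), <- Nat2Z.inj_succ, !it_nat. reflexivity.
  - assert (exists n, z = (- Z.of_nat (S n))%Z) as [n ->].
    { exists (Z.to_nat (- z - 1)). lia. }
    replace (Z.succ (- Z.of_nat (S n))) with (- Z.of_nat n)%Z by lia.
    rewrite !it_opp_nat. simpl. now rewrite HTS.
Qed.

Lemma it_pred z x : it (Z.pred z) x = Ti (it z x).
Proof. rewrite <- (Z.succ_pred z) at 2. now rewrite it_succ, HST. Qed.

Lemma it_add a b x : it (a + b) x = it a (it b x).
Proof.
  induction a as [|a IH|a IH] using Z.peano_ind; [reflexivity| |].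
  - now rewrite Z.add_succ_l, !it_succ, IH.
  - now rewrite Z.add_pred_l, !it_pred, IH.
Qed.

Lemma it_comm a b x : it a (it b x) = it b (it a x).
Proof. now rewrite <- !it_add, Z.add_comm. Qed.

Lemma it_continuous a : continuous_map d (it a).
Proof.
  assert (Hc : forall h g, continuous_map d h -> continuous_map d g ->
    continuous_map d (fun x => h (g x))).
  { intros h g Hh Hg x e He. destruct (Hh (g x) e He) as [r [Hr H]].
    destruct (Hg x r Hr) as [r' [Hr' H']]. exists r'; split; auto. }
  induction a as [|a IH|a IH] using Z.peano_ind.
  - intros x e He; exists e; auto.
  - intros x e He. destruct (Hc T (it a) HT IH x e He) as [r [Hr H]].
    exists r; split; [exact Hr|]. intros y; rewrite !it_succ; apply H.
  - intros x e He. destruct (Hc Ti (it a) HS IH x e He) as [r [Hr H]].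
    exists r; split; [exact Hr|]. intros y; rewrite !it_pred; apply H.
Qed.

Lemma cube_continuous k n (w : (nat -> bool) -> X) e :
  (forall a b, agree k a b -> w a = w b) -> 0 < e ->
  exists r, 0 < r /\ forall a y, d (w a) y < r ->
    d (it (dotz k n a) (w a)) (it (dotz k n a) y) < e.
Proof.
  intros Hw He.
  (* Sets containing all sufficiently small radii are stable under intersection, so [bits_uniform]
     yields one radius for all vertices. *)
  assert (H : exists r, 0 < r /\ forall r', 0 < r' <= r -> forall a, forall y,
    d (w a) y < r' -> d (it (dotz k n a) (w a)) (it (dotz k n a) y) < e).
  { apply (bits_uniform (fun A : R -> Prop => exists r, 0 < r /\ forall r', 0 < r' <= r -> A r'))
      with (k := k).
    - intros A B [r [Hr HA]] [s [Hs HB]]. exists (Rmin r s); split; [now apply Rmin_pos|].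
      intros r' Hr'. pose proof (Rmin_l r s); pose proof (Rmin_r r s).
      split; [apply HA|apply HB]; lra.
    - intros A B [r [Hr HA]] HAB. exists r; auto.
    - intros a b r Hab h y. rewrite <- (Hw a b Hab), <- (dotz_agree k n a b Hab). apply h.
    - intros a. destruct (it_continuous (dotz k n a) (w a) e He) as [r [Hr H]].
      exists r; split; [exact Hr|]. intros r' Hr' y Hy; apply H; lra. }
  destruct H as [r [Hr H]]. exists r; split; [exact Hr|]. apply H; lra.
Qed.

Lemma orbit_dense x z e : 0 < e -> exists k : nat, d (it (Z.of_nat k) x) z < e.
Proof.
  intros He. destruct (Hmin x z e He) as [y [[k ->] H]].
  exists k. now rewrite it_nat, dist_sym.
Qed.

(** The ultrafilters concentrated at plus infinity form a closed left ideal; a minimal ideal inside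
    it gives return times as large as desired. *)
Lemma recurrent_ideal : exists L : beta Z -> Prop, closedb L /\ (exists p, L p) /\
  left_ideal Z.add L /\ (forall p, L p -> forall m, mem p (fun k => (m <= k)%Z)) /\
  forall u v, L u -> L v -> mulb Z.add v v = v -> mulb Z.add u v = u.
Proof.
  destruct (minimal_left_ideal Z.add Z.add_assoc
    (fun p => forall m, mem p (fun k => (m <= k)%Z))) as [L HL].
  - apply closedb_forall; intros m; apply closedb_basic.
  - destruct (ultra_extend (fun A => exists m, A = fun k => (m <= k)%Z)) as [p Hp].
    + exists (fun k => (0 <= k)%Z); eauto.
    + intros A B [m ->] [m' ->]. exists (fun k => (Z.max m m' <= k)%Z).
      split; [eauto|]. intros a Ha; lia.
    + intros A [m ->]; exists m; lia.
    + exists p; intros m; apply Hp; eauto.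
  - intros p q Hq m. apply (mem_all p); intros a.
    apply (mem_mono q _ _ (Hq (m - a)%Z)); intros b Hb; lia.
  - exists L. exact HL.
Qed.

Lemma plim_add p q x : plim (mulb Z.add p q) (fun k => it k x) =
  plim p (fun k => it k (plim q (fun k => it k x))).
Proof.
  rewrite plim_mulb. apply plim_ext; intros a.
  rewrite <- (plim_continuous q (fun k => it k x) (it a) (it_continuous a)).
  apply plim_ext; intros b; apply it_add.
Qed.

(** Converts approximations at every scale [e] into one ultrafilter, along which exact limits can be
    taken. *)
Lemma beta_decreasing {M : Type} (A : R -> M -> Prop) :
  (forall e, 0 < e -> exists a, A e a) ->
  (forall e e' a, 0 < e <= e' -> A e a -> A e' a) ->
  exists p : beta M, forall e, 0 < e -> mem p (A e).
Proof.
  intros H Hm.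
  destruct (ultra_extend (fun B => exists e, 0 < e /\ B = A e)) as [p Hp].
  - exists (A 1), 1; split; [lra|reflexivity].
  - intros B C [e [He ->]] [e' [He' ->]]. exists (A (Rmin e e')).
    pose proof (Rmin_pos e e' He He'); pose proof (Rmin_l e e'); pose proof (Rmin_r e e').
    split; [eauto|]. intros a Ha; split; apply (Hm (Rmin e e')); auto.
  - intros B [e [He ->]]; auto.
  - exists p; intros e He; apply Hp; eauto.
Qed.

(** The elements of [L] fixing [x] form a closed subsemigroup, to which [ellis] applies. It is
    nonempty: for [p] in [L], density of the orbit of the limit of [x] along [p] gives a [q]
    carrying this limit back to [x], and [q] times [p] is in [L]. *)
Lemma idempotent_fixing (L : beta Z -> Prop) x :
  closedb L -> (exists p, L p) -> left_ideal Z.add L ->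
  exists u, L u /\ mulb Z.add u u = u /\ plim u (fun k => it k x) = x.
Proof.
  intros Lc [p Hp] Ll.
  destruct (ellis Z.add Z.add_assoc
    (fun u => L u /\ forall i : {e | 0 < e}, mem u (fun k => d (it k x) x < proj1_sig i)))
    as [u [[h1 h2] h3]].
  - apply closedb_and; [exact Lc|]. apply closedb_forall; intros i; apply closedb_basic.
  - destruct (beta_decreasing (fun e k => d (it k (plim p (fun k => it k x))) x < e)) as [q Hq].
    + intros e He. destruct (orbit_dense (plim p (fun k => it k x)) x e He) as [k Hk]; eauto.
    + intros e e' a He h; lra.
    + exists (mulb Z.add q p); split; [now apply Ll|].
      intros [e He]. assert (E : plim (mulb Z.add q p) (fun k => it k x) = x).
      { rewrite plim_add; now apply plim_eq. }
      pose proof (tends_plim (mulb Z.add q p) (fun k => it k x) e He) as h.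
      rewrite E in h; exact h.
  - assert (E : forall u, (forall i : {e | 0 < e}, mem u (fun k => d (it k x) x < proj1_sig i))
      -> plim u (fun k => it k x) = x).
    { intros u Hu; apply plim_eq; intros e He. exact (Hu (exist _ e He)). }
    intros u v [hu hu'] [hv hv']; split; [now apply Ll|].
    intros [e He]. pose proof (tends_plim (mulb Z.add u v) (fun k => it k x) e He) as h.
    rewrite plim_add, (E v hv'), (E u hu') in h; exact h.
  - exists u; split; [exact h1|split; [exact h3|]].
    apply plim_eq; intros e He. exact (h2 (exist _ e He)).
Qed.

Notation "p ** q" := (mulb addv p q) (at level 40, left associativity).

(** * Face transformations of cubes *)

Definition act (k : nat) (p : beta (nat -> Z)) (e : nat -> bool) (x : X) : X :=
  plim p (fun n => it (dotz k n e) x).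

Lemma act_mul k p q e x : act k (p ** q) e x = act k p e (act k q e x).
Proof.
  unfold act. rewrite plim_mulb. apply plim_ext; intros a.
  rewrite <- (plim_continuous q (fun n => it (dotz k n e) x) _ (it_continuous (dotz k a e))).
  apply plim_ext; intros b. now rewrite dotz_addv, it_add.
Qed.

Lemma act_push k p e x :
  act k p e x = plim (pushb (fun n => dotz k n e) p) (fun z => it z x).
Proof. now rewrite plim_pushb. Qed.

Lemma act_zero k p e x : ~ nonzero k e -> act k p e x = x.
Proof.
  intros H. unfold act. transitivity (plim p (fun _ => x)); [|apply plim_const].
  apply plim_ext; intros n.
  now rewrite dotz_zero.
Qed.

Lemma act_agree k p e v x : agree k e v -> act k p e x = act k p v x.
Proof. intros H; apply plim_ext; intros n. now rewrite (dotz_agree k n e v H). Qed.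

Fixpoint power (u : beta Z) (k : nat) : beta (nat -> Z) :=
  match k with
  | O => principal (fun _ => 0%Z)
  | S k => power u k ** pushb (axis k) u
  end.

(** Projecting along [e] turns the factor on axis [i] into [u] if [e i] is true and into the neutral
    element otherwise; idempotence collapses the remaining product of copies of [u]. *)
Lemma push_power u k e j : mulb Z.add u u = u -> (j <= k)%nat ->
  pushb (fun n => dotz k n e) (power u j) = u /\ nonzero j e \/
  pushb (fun n => dotz k n e) (power u j) = principal 0%Z /\ ~ nonzero j e.
Proof.
  intros Hu; induction j as [|j IH]; intros Hj; simpl power.
  - right; split; [|intros [i [Hi _]]; lia].
    apply beta_ext; intros A HA; simpl in *.
    now rewrite dotz_0 in HA.
  - rewrite (pushb_mulb addv Z.add) by (intros; apply dotz_addv).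
    assert (E : pushb (fun n => dotz k n e) (pushb (axis j) u) =
      if e j then u else principal 0%Z).
    { apply beta_ext; intros A HA; simpl in *. destruct (e j) eqn:Ej.
      - apply (mem_mono u _ _ HA); intros t; now rewrite dotz_axis, Ej.
      - destruct (mem_ex u _ HA) as [t Ht]. rewrite dotz_axis, Ej in Ht; [exact Ht|lia]. }
    rewrite E; clear E.
    assert (Hr : forall p, mulb Z.add p (principal 0%Z) = p).
    { intros p; apply beta_ext; intros A HA; simpl in *.
      apply (mem_mono p _ _ HA); intros t; now rewrite Z.add_0_r. }
    assert (Hl : forall p, mulb Z.add (principal 0%Z) p = p).
    { intros p; now apply beta_ext. }
    destruct (IH ltac:(lia)) as [[E H]|[E H]]; rewrite E; destruct (e j) eqn:Ej.
    + left; rewrite Hu; split; [reflexivity|]. exists j; auto.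
    + left; rewrite Hr; split; [reflexivity|]. destruct H as [i [h1 h2]]; exists i; auto.
    + left; rewrite Hl; split; [reflexivity|]. exists j; auto.
    + right; rewrite Hr; split; [reflexivity|]. intros [i [h1 h2]].
      destruct (Nat.eq_dec i j) as [->|]; [congruence|]. apply H; exists i; split; [lia|auto].
Qed.

Lemma act_power u k e x : mulb Z.add u u = u -> plim u (fun k => it k x) = x ->
  act k (power u k) e x = x.
Proof.
  intros Hu Hx. rewrite act_push.
  destruct (push_power u k e k Hu (le_n k)) as [[E _]|[E _]]; rewrite E; [exact Hx|].
  apply plim_eq; intros r Hr; simpl. now rewrite dist_self.
Qed.

Lemma mem_power_ge u k m : (forall m, mem u (fun k => (m <= k)%Z)) ->
  mem (power u k) (fun n => forall i, (i < k)%nat -> (m <= n i)%Z).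
Proof.
  (* Vanishing of the coordinates from [k] on is carried along, so that the next factor puts exactly
     [t] in coordinate [k]. *)
  intros Hu. assert (H : mem (power u k) (fun n => forall i,
    ((i < k)%nat -> (m <= n i)%Z) /\ ((k <= i)%nat -> n i = 0%Z))).
  { induction k as [|k IH]; simpl.
    - intros i; split; [lia|reflexivity].
    - apply (mem_mono _ _ _ IH); intros a Ha. apply (mem_mono u _ _ (Hu m)); intros t Ht i.
      unfold addv, axis, setv. destruct (Ha i) as [h1 h2]. destruct (Nat.eq_dec i k) as [->|].
      + rewrite h2 by lia. split; lia.
      + split; intros h; [rewrite Z.add_0_r; apply h1; lia|rewrite h2; lia]. }
  apply (mem_mono _ _ _ H); intros n Hn i Hi. now apply Hn.
Qed.

Lemma cube_recurrence k x e m : 0 < e -> exists n, (forall i, (i < k)%nat -> (m <= n i)%Z) /\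
  forall a, d (it (dotz k n a) x) x < e.
Proof.
  intros He. destruct recurrent_ideal as [L [Lc [Ln [Ll [Lw _]]]]].
  destruct (idempotent_fixing L x Lc Ln Ll) as [u [Lu [Hu Hx]]].
  apply (mem_ex (power u k)). apply mem_and; [now apply mem_power_ge; apply Lw|].
  apply mem_bits with (k := k).
  - intros a b n Hab; now rewrite (dotz_agree k n a b Hab).
  - intros a. pose proof (tends_plim (power u k) (fun n => it (dotz k n a) x) e He) as h.
    fold (act k (power u k) a x) in h. now rewrite act_power in h.
Qed.

(* The projection of [w] along every nonzero [e] is the minimal idempotent [u], hence [w ** v]
   projects like [w] for each idempotent [v] of the left ideal generated by [w ** q ** w]. *)
Lemma cube_return k y q : exists s, forall e, act k s e (act k q e y) = y.
Proof.
  destruct recurrent_ideal as [L [Lc [Ln [Ll [Lw Lm]]]]].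
  destruct (idempotent_fixing L y Lc Ln Ll) as [u [Lu [Hu Hy]]].
  set (w := power u k).
  destruct (ellis addv addv_assoc (fun r => exists a, True /\ a ** (w ** q ** w) = r))
    as [v [[a [_ Ha]] Hv]].
  - apply (closedb_image_mul addv (fun _ => True)). intros p _; exact I.
  - exists (w ** (w ** q ** w)), w; auto.
  - intros r r' [a [_ <-]] [b [_ <-]]. exists (a ** (w ** q ** w) ** b); split; [exact I|].
    now rewrite !(mulbA addv addv_assoc).
  (* Since [v = a ** (w ** q ** w)] and [w] fixes [y], the identity for [w ** v] at [y] says that
     [w ** a ** w] undoes [q]. *)
  - exists (w ** a ** w); intros e.
    destruct (classic (nonzero k e)) as [N|N]; [|now rewrite !act_zero].
    assert (E : act k (w ** v) e y = y).
    { rewrite act_push, (pushb_mulb addv Z.add) by (intros; apply dotz_addv).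
      assert (Ew : pushb (fun n => dotz k n e) w = u).
      { destruct (push_power u k e k Hu (le_n k)) as [[E _]|[_ E]]; [exact E|contradiction]. }
      rewrite Ew, Lm; [exact Hy|exact Lu| |].
      - rewrite <- Ha, !(mulbA addv addv_assoc).
        rewrite (pushb_mulb addv Z.add) by (intros; apply dotz_addv).
        rewrite Ew. now apply Ll.
      - rewrite <- (pushb_mulb addv Z.add) by (intros; apply dotz_addv). now rewrite Hv. }
    rewrite <- Ha, !(mulbA addv addv_assoc), !act_mul in E.
    rewrite !act_mul. unfold w in *; now rewrite (act_power u k e y Hu Hy) in E.
Qed.

Lemma dotz_S_setv k n a b :
  dotz (S k) n (setv a k b) = (dotz k n a + if b then n k else 0)%Z.
Proof. simpl. now rewrite setv_eq, (dotz_agree k n _ a (setv_agree k a b)). Qed.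

(** With a zero last coordinate, a face transformation of dimension [k] acts alike on the lower and
    the upper face. *)
Lemma act_trunc k s a x : act (S k) (pushb (fun n => setv n k 0%Z) s) a x = act k s a x.
Proof.
  unfold act. rewrite plim_pushb. apply plim_ext; intros n. simpl dotz.
  rewrite dotz_setv, setv_eq. f_equal. destruct (a k); lia.
Qed.

(** * The closed set of cubes *)

Definition cubeQ (k : nat) (w : (nat -> bool) -> X) : Prop :=
  forall e, 0 < e -> exists z n, forall a, d (it (dotz k n a) z) (w a) < e.

Lemma cubeQ_agree k w a b : cubeQ k w -> agree k a b -> w a = w b.
Proof.
  intros HQ H. apply dist_eq; intros e He. destruct (HQ (e/2) ltac:(lra)) as [z [n h]].
  pose proof (h a) as h1; pose proof (h b) as h2. rewrite (dotz_agree k n a b H) in h1.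
  rewrite dist_sym in h1. pose proof (dist_tri (w a) (it (dotz k n b) z) (w b)); lra.
Qed.

Lemma cubeQ_const k x : cubeQ k (fun _ => x).
Proof.
  intros e He; exists x, (fun _ => 0%Z); intros a.
  now rewrite dotz_0; simpl; rewrite dist_self.
Qed.

(** First an [n] close to the limit at all vertices is fixed; then [w] is approximated by a cube
    finely enough for this [n], and the exponents add. *)
Lemma cubeQ_act k p w : cubeQ k w -> cubeQ k (fun a => act k p a (w a)).
Proof.
  intros HQ e He.
  destruct (mem_ex p (fun n => forall a, d (it (dotz k n a) (w a)) (act k p a (w a)) < e/2))
    as [n Hn].
  - apply mem_bits with (k := k).
    + intros a b n Hab. now rewrite (cubeQ_agree k w a b HQ Hab), (act_agree k p a b _ Hab),
        (dotz_agree k n a b Hab).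
    + intros a. apply tends_plim; lra.
  - destruct (cube_continuous k n w (e/2)) as [r [Hr H]]; [intros a b; now apply cubeQ_agree|lra|].
    destruct (HQ r Hr) as [z [m Hz]]. exists z, (addv n m); intros a.
    rewrite dotz_addv, it_add.
    pose proof (Hz a) as h1. rewrite dist_sym in h1. apply H in h1. rewrite dist_sym in h1.
    pose proof (Hn a) as h2. cbv beta in h2.
    eapply Rle_lt_trans; [apply (dist_tri _ (it (dotz k n a) (w a)))|]; lra.
Qed.

Lemma cubeQ_face k w b : cubeQ (S k) w -> cubeQ k (fun a => w (setv a k b)).
Proof.
  intros HQ e He. destruct (HQ e He) as [z [n H]].
  exists (it (if b then n k else 0%Z) z), n; intros a.
  rewrite <- it_add, <- dotz_S_setv. apply H.
Qed.

(** As the orbit of [x] is dense, the base of a cube approximating [w] may be taken to be an iterate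
    of [x]; so [w] is a limit of upper faces of cubes of dimension [k + 1] based at [x].
    [cube_return] inverts this limit, and [n k] is the common shift of the upper face. *)
Lemma cubeQ_to_const k w x : cubeQ k w ->
  exists g, forall a, plim g (fun n => it (n k + dotz k n a) (w a)) = x.
Proof.
  intros HQ.
  destruct (beta_decreasing (fun e n => forall a,
    d (it (dotz (S k) n (setv a k true)) x) (w a) < e)) as [q Hq].
  - intros e He. destruct (HQ (e/2) ltac:(lra)) as [z [m Hz]].
    destruct (cube_continuous k m (fun _ => z) (e/2)) as [r [Hr H]]; [auto|lra|].
    destruct (orbit_dense x z r Hr) as [j Hj].
    exists (setv m k (Z.of_nat j)); intros a.
    rewrite dotz_S_setv, setv_eq, dotz_setv, it_add.
    pose proof (H a (it (Z.of_nat j) x) ltac:(now rewrite dist_sym)) as h1.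
    rewrite dist_sym in h1. pose proof (Hz a) as h2.
    eapply Rle_lt_trans; [apply (dist_tri _ (it (dotz k m a) z))|]; cbv beta in *; lra.
  - intros e e' n He h a. pose proof (h a); lra.
  - destruct (cube_return (S k) x q) as [s Hs]. exists s; intros a.
    rewrite <- (Hs (setv a k true)). unfold act at 1. apply plim_ext; intros n.
    assert (E : act (S k) q (setv a k true) x = w a).
    { apply plim_eq; intros e He. apply (mem_mono q _ _ (Hq e He)); auto. }
    now rewrite E, dotz_S_setv, Z.add_comm.
Qed.

(* Induction on [k]: one first makes the lower face constant. If [g], a limit of
   [(it (m + n.a))_a], then maps the cube to the constant [x], two suitable limits [h1] and [h2]
   of face transformations send the cube and the constant cube [x] to the same point,
   and [cube_return] brings the latter back. *)
Lemma cubeQ_contract k : forall w x, cubeQ k w -> w (fun _ => false) = x ->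
  exists s, forall a, act k s a (w a) = x.
Proof.
  induction k as [|k IH]; intros w x HQ Hx.
  - exists (principal (fun _ => 0%Z)); intros a.
    rewrite act_zero by (intros [i [Hi _]]; lia). rewrite <- Hx.
    apply (cubeQ_agree 0); [exact HQ|intros i Hi; lia].
  - destruct (IH (fun a => w (setv a k false)) x) as [s Hs].
    { now apply cubeQ_face. }
    { rewrite <- Hx. apply (cubeQ_agree (S k)); [exact HQ|]. now apply setv_same. }
    set (s' := pushb (fun n => setv n k 0%Z) s).
    assert (Hs' : forall a, a k = false -> act (S k) s' a (w a) = x).
    { intros a Ha. rewrite <- (Hs a). unfold s'; rewrite act_trunc. f_equal.
      apply (cubeQ_agree (S k)); [exact HQ|]. intros i Hi; symmetry.
      now apply (setv_same k a false Ha). }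
    set (w1 := fun a => act (S k) s' a (w a)).
    assert (HQ1 : cubeQ (S k) w1) by now apply cubeQ_act.
    destruct (cubeQ_to_const (S k) w1 x HQ1) as [g Hg].
    (* On the upper face [h1] moves [w1] as [g] does, giving [x], and [h2] moves the constant [x] as
       [g] moves the lower face of [w1], which is [x] too. On the lower face both move [x] in the
       same way. *)
    set (h1 := pushb (fun n => setv n k (n k + n (S k))%Z) g).
    set (h2 := pushb (fun n => setv n k (n (S k))) g).
    destruct (cube_return (S k) x h2) as [t Ht].
    exists (t ** (h1 ** s')); intros a. rewrite !act_mul, <- (Ht a). f_equal.
    fold (w1 a). unfold act, h1, h2. rewrite !plim_pushb.
    destruct (a k) eqn:Ha.
    + transitivity x.
      * refine (eq_trans _ (Hg a)); apply plim_ext; intros n. simpl dotz.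
        rewrite dotz_setv, Ha, setv_eq. f_equal; lia.
      * symmetry; refine (eq_trans _ (Hg (setv a k false))). apply plim_ext; intros n.
        rewrite dotz_S_setv. simpl dotz. rewrite dotz_setv, Ha, setv_eq.
        unfold w1; rewrite Hs' by apply setv_eq. f_equal; lia.
    + apply plim_ext; intros n. simpl dotz. rewrite !dotz_setv, Ha.
      unfold w1; now rewrite Hs'.
Qed.

(** * Regionally proximal pairs and finite IP-sets *)

Lemma subsum_setv k p a b :
  subsum (S k) p (setv a k b) = (subsum k p a + if b then p k else 0)%nat.
Proof.
  simpl. rewrite setv_eq. f_equal. pose proof (setv_agree k a b) as H.
  revert H; generalize (setv a k b); intros v H. induction k as [|k IH]; simpl; [reflexivity|].
  rewrite IH, (H k); [reflexivity|lia|]. intros i Hi; apply H; lia.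
Qed.

Lemma dotz_of_nat k p a : dotz k (fun i => Z.of_nat (p i)) a = Z.of_nat (subsum k p a).
Proof. induction k; simpl; [reflexivity|]. rewrite IHk; destruct (a k); lia. Qed.

Lemma subsum_zero k p : subsum k p (fun _ => false) = 0%nat.
Proof. induction k; simpl; lia. Qed.

Lemma fip_pred A l : contains_fip A (S l) -> contains_fip A l.
Proof.
  intros [p [Hp H]]. exists p; split; [auto|]. intros a [i [Hi Ha]].
  pose proof (subsum_setv l p a false) as E. rewrite Nat.add_0_r in E.
  rewrite <- E. apply H. exists i; split; [lia|]. rewrite setv_neq; [exact Ha|lia].
Qed.

Lemma fip_mono (A B : nat -> Prop) l :
  (forall n, A n -> B n) -> contains_fip A l -> contains_fip B l.
Proof. intros H [p [h1 h2]]; exists p; auto. Qed.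

(** The last generator serves as displacement: [y'] is [x'] moved by [p k], hence close to [y]. A
    nonempty sum of the others, with or without [p k] added, stays in the IP-set, so at that time
    both [x'] and [y'] are near [y]. *)
Lemma RP_of_fip k x y :
  (forall e, 0 < e -> exists x', d x x' < e /\
     contains_fip (fun n => d (Nat.iter n T x') y < e) (S k)) ->
  RP d T Ti k x y.
Proof.
  intros H delta Hdelta. destruct (H (delta/2) ltac:(lra)) as [x' [Hx [p [_ Hp]]]].
  exists x', (it (Z.of_nat (p k)) x'), (fun i => Z.of_nat (p i)).
  split; [lra|split].
  - rewrite it_nat, dist_sym. apply Rlt_trans with (delta/2); [|lra].
    pose proof (subsum_setv k p (fun _ => false) true) as E.
    rewrite subsum_zero in E; simpl plus in E. rewrite <- E; apply Hp.
    exists k; split; [lia|apply setv_eq].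
  - intros a [i [Hi Ha]]. rewrite <- it_add, dotz_of_nat, <- Nat2Z.inj_add, !it_nat.
    pose proof (subsum_setv k p a true) as E; pose proof (subsum_setv k p a false) as E'.
    rewrite Nat.add_0_r in E'. rewrite <- E, <- E'.
    assert (H1 : forall b, d (Nat.iter (subsum (S k) p (setv a k b)) T x') y < delta/2).
    { intros b; apply Hp. exists i; split; [lia|]. rewrite setv_neq; [exact Ha|lia]. }
    pose proof (H1 false) as h1; pose proof (H1 true) as h2; rewrite dist_sym in h2.
    eapply Rle_lt_trans; [apply (dist_tri _ y)|lra].
Qed.

Lemma bounded_below (n : nat -> Z) k : exists m, forall i, (i < k)%nat -> (m <= n i)%Z.
Proof.
  induction k as [|k [m H]]; [exists 0%Z; lia|].
  exists (Z.min m (n k)); intros i Hi. destruct (Nat.eq_dec i k) as [->|]; [lia|].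
  specialize (H i ltac:(lia)); lia.
Qed.

(* Adding to [n] a vector of large return times of the constant cube [z] makes it positive. *)
Lemma cube_positive k z n j e : 0 < e ->
  exists p, (forall i, (i < k)%nat -> (1 <= p i)%nat) /\ forall a,
    d (it (Z.of_nat (subsum k p a)) z) (it (dotz k n a) z) < e /\
    d (it (Z.of_nat (subsum k p a)) (it j z)) (it (dotz k n a) (it j z)) < e.
Proof.
  intros He. destruct (bounded_below n k) as [m Hm].
  (* The extra coordinate [j] treats the base points [z] and [it j z] at once. *)
  destruct (cube_continuous (S k) (setv n k j) (fun _ => z) e) as [r [Hr H]]; [auto|exact He|].
  destruct (cube_recurrence k z r (1 - m) Hr) as [q [Hq Hr']].
  exists (fun i => Z.to_nat (n i + q i)). split.
  { intros i Hi. specialize (Hm i Hi); specialize (Hq i Hi); lia. }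
  intros a.
  assert (E : Z.of_nat (subsum k (fun i => Z.to_nat (n i + q i)) a) =
    (dotz k n a + dotz k q a)%Z).
  { rewrite <- dotz_of_nat, <- dotz_addv. apply dotz_ext; [|now intros i _].
    intros i Hi. specialize (Hm i Hi); specialize (Hq i Hi). unfold addv; lia. }
  rewrite E.
  assert (H1 : forall b : bool, d (it (dotz k n a + if b then j else 0) z)
     (it (dotz k n a + if b then j else 0) (it (dotz k q a) z)) < e).
  { intros b. pose proof (H (setv a k b) (it (dotz k q a) z)
      ltac:(rewrite dist_sym; apply Hr')) as h.
    now rewrite dotz_S_setv, setv_eq, dotz_setv in h. }
  split.
  - pose proof (H1 false) as h. rewrite Z.add_0_r in h. now rewrite dist_sym, it_add.
  - pose proof (H1 true) as h. rewrite <- it_add in h. rewrite dist_sym, <- !it_add.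
    replace (dotz k n a + dotz k q a + j)%Z with (dotz k n a + j + dotz k q a)%Z by lia.
    exact h.
Qed.

(** The vertices are limits of [x'] moved over the lower face and of [y'] moved over the upper one.
    The limit is in [cubeQ] because, by minimality, an iterate of [x'] approximates [y'], and its
    exponent serves as last coordinate. *)
Lemma RP_cube k x y : RP d T Ti k x y -> exists w, cubeQ (S k) w /\
  (forall a, ~ nonzero k a -> w (setv a k false) = x /\ w (setv a k true) = y) /\
  (forall a, nonzero k a -> w (setv a k false) = w (setv a k true)).
Proof.
  intros H.
  destruct (beta_decreasing (fun e (m : X * X * (nat -> Z)) =>
    let '(x', y', n) := m in d x x' < e /\ d y y' < e /\
      forall a, nonzero k a -> d (it (dotz k n a) x') (it (dotz k n a) y') < e)) as [p Hp].
  - intros e He. destruct (H e He) as [x' [y' [n [h1 [h2 h3]]]]].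
    exists (x', y', n); auto.
  - intros e e' [[x' y'] n] He [h1 [h2 h3]]. split; [lra|split; [lra|]].
    intros a Ha; specialize (h3 a Ha); lra.
  - set (pt := fun (a : nat -> bool) (m : X * X * (nat -> Z)) => let '(x', y', n) := m in
      it (dotz k n a) (if a k then y' else x')).
    set (w := fun a => plim p (pt a)). exists w. split; [|split].
    + intros e He.
      destruct (mem_ex p (fun m => forall a, d (pt a m) (w a) < e/2)) as [[[x' y'] n] Hn].
      { apply mem_bits with (k := S k).
        - intros a b [[x' y'] n] Hab.
          assert (E : forall m, pt a m = pt b m).
          { intros [[x1 y1] n1]. unfold pt. rewrite (Hab k) by lia.
            rewrite (dotz_agree k n1 a b); [reflexivity|intros i Hi; apply Hab; lia]. }
          rewrite E. unfold w. now rewrite (plim_ext p (pt a) (pt b) E).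
        - intros a; apply tends_plim; lra. }
      destruct (cube_continuous k n (fun _ => y') (e/2)) as [r [Hr Hc]]; [auto|lra|].
      destruct (orbit_dense x' y' r Hr) as [j Hj].
      exists x', (setv n k (Z.of_nat j)); intros a. simpl dotz. rewrite setv_eq, dotz_setv.
      pose proof (Hn a) as h1. unfold pt in h1. destruct (a k).
      * pose proof (Hc a (it (Z.of_nat j) x') ltac:(now rewrite dist_sym)) as h2.
        rewrite dist_sym in h2. rewrite it_add.
        eapply Rle_lt_trans; [apply (dist_tri _ (it (dotz k n a) y'))|lra].
      * rewrite Z.add_0_r; lra.
    + intros a Ha; split; apply plim_eq; intros e He;
      apply (mem_mono p _ _ (Hp e He)); intros [[x' y'] n] [h1 [h2 _]];
      unfold pt; rewrite setv_eq, (dotz_agree k n _ a (setv_agree k a _)), dotz_zero by exact Ha;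
      simpl iterz; now rewrite dist_sym.
    + intros a Ha; apply plim_eq; intros e He.
      apply (mem_mono p _ _ (mem_and p _ _ (Hp (e/2) ltac:(lra))
        (tends_plim p (pt (setv a k true)) (e/2) ltac:(lra)))).
      intros [[x' y'] n] [[_ [_ h]] h']. specialize (h a Ha).
      assert (Hpt : forall b : bool,
        pt (setv a k b) (x', y', n) = it (dotz k n a) (if b then y' else x')).
      { intros b; unfold pt. now rewrite setv_eq, (dotz_agree k n _ a (setv_agree k a b)). }
      fold (w (setv a k true)) in h'. rewrite Hpt in *.
      eapply Rle_lt_trans; [apply (dist_tri _ (it (dotz k n a) y'))|lra].
Qed.

(** Contracting the upper face of the cube from [RP_cube] to [y] leaves [x] at the base and [y] at
    all other vertices. A second contraction [s2] makes this cube constant [x], so at nonzero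
    vertices it sends [y] to [x]; the [t] that brings the constant cube [y] back after [s2]
    therefore carries [x] to [y] there. *)
Lemma RP_fip k x y e : RP d T Ti k x y -> 0 < e ->
  contains_fip (fun n => d (Nat.iter n T x) y < e) (S k).
Proof.
  intros HRP He. destruct (RP_cube k x y HRP) as [w [HQ [H0 H1]]].
  assert (Hw : forall a, w (setv a k (a k)) = w a).
  { intros a. apply (cubeQ_agree (S k)); [exact HQ|]. now apply setv_same. }
  destruct (cubeQ_contract k (fun a => w (setv a k true)) y) as [s Hs].
  { now apply cubeQ_face. }
  { apply H0. intros [i [_ Hi]]; discriminate. }
  set (w1 := fun a => act (S k) (pushb (fun n => setv n k 0%Z) s) a (w a)).
  assert (Hy : forall a, nonzero (S k) a -> w1 a = y).
  { intros a Ha. unfold w1. rewrite act_trunc, <- (Hs a). f_equal.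
    rewrite <- (Hw a). destruct (a k) eqn:Ea; [reflexivity|]. apply H1.
    destruct Ha as [i [Hi Ha]]. exists i; split; [|exact Ha].
    destruct (Nat.eq_dec i k); [congruence|lia]. }
  assert (Hx : w1 (fun _ => false) = x).
  { unfold w1. rewrite act_zero by (intros [i [_ Hi]]; discriminate).
    rewrite <- (Hw (fun _ => false)). apply H0. intros [i [_ Hi]]; discriminate. }
  destruct (cubeQ_contract (S k) w1 x) as [s2 Hs2]; [now apply cubeQ_act|exact Hx|].
  destruct (cube_return (S k) y s2) as [t Ht].
  destruct (mem_ex t (fun n => forall a, nonzero (S k) a ->
    d (it (dotz (S k) n a) x) y < e/2)) as [n Hn].
  { apply mem_bits with (k := S k).
    - intros a b n Hab h Hb. rewrite <- (dotz_agree (S k) n a b Hab). apply h.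
      apply (nonzero_agree (S k) b a); [|exact Hb]. intros i Hi; symmetry; auto.
    - intros a. destruct (classic (nonzero (S k) a)) as [Ha|Ha].
      + apply (mem_mono t (fun n => d (it (dotz (S k) n a) x) y < e/2)); [|auto].
        pose proof (Ht a) as h. rewrite <- (Hy a Ha) in h at 1. rewrite Hs2 in h.
        rewrite <- h. apply tends_plim; lra.
      + apply mem_all; intros n h; contradiction. }
  destruct (cube_positive (S k) x n 0 (e/2)) as [p [Hp Hp']]; [lra|].
  exists p; split; [exact Hp|]. intros a Ha. rewrite <- it_nat.
  eapply Rle_lt_trans; [apply (dist_tri _ (it (dotz (S k) n a) x))|].
  pose proof (Hn a Ha); pose proof (proj1 (Hp' a)); lra.
Qed.

Lemma RPinf_fip x y e l : RPinf d T Ti x y -> 0 < e ->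
  contains_fip (fun n => d (Nat.iter n T x) y < e) l.
Proof.
  (* [RPinf] covers orders from 1 on only, so order [S l] is used; it gives length [S (S l)]. *)
  intros H He. apply fip_pred, fip_pred, RP_fip; [apply H; lia|exact He].
Qed.

Lemma RPinf_of_fip x y :
  (forall e l, 0 < e -> exists x', d x x' < e /\
     contains_fip (fun n => d (Nat.iter n T x') y < e) l) ->
  RPinf d T Ti x y.
Proof. intros H k _. apply RP_of_fip; auto. Qed.

Lemma RPinf_refl x : RPinf d T Ti x x.
Proof.
  intros k _ e He. exists x, x, (fun _ => 0%Z). rewrite !dist_self.
  split; [exact He|split; [exact He|]]. intros a _. now rewrite dist_self.
Qed.

Lemma RPinf_sym x y : RPinf d T Ti x y -> RPinf d T Ti y x.
Proof.
  intros H k Hk e He. destruct (H k Hk e He) as [x' [y' [n [h1 [h2 h3]]]]].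
  exists y', x', n. split; [exact h2|split; [exact h1|]].
  intros a Ha. rewrite dist_sym; auto.
Qed.

(** Generators are added: a sum of [p] brings [x] so close to [y] that the corresponding sum of [q],
    which brings [y] near [z], brings it near [z] as well. *)
Lemma RPinf_trans x y z : RPinf d T Ti x y -> RPinf d T Ti y z -> RPinf d T Ti x z.
Proof.
  intros Hxy Hyz. apply RPinf_of_fip. intros e l He. exists x.
  split; [now rewrite dist_self|].
  destruct (RPinf_fip y z (e/2) l Hyz ltac:(lra)) as [q [Hq Hq']].
  destruct (cube_continuous l (fun i => Z.of_nat (q i)) (fun _ => y) (e/2)) as [r [Hr H]];
    [auto|lra|].
  destruct (RPinf_fip x y r l Hxy Hr) as [p [Hp Hp']].
  exists (fun i => p i + q i)%nat. split; [intros i Hi; specialize (Hp i Hi); lia|].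
  intros a Ha.
  pose proof (Hq' a Ha) as h1. pose proof (Hp' a Ha) as h2.
  assert (E : subsum l (fun i => p i + q i)%nat a = (subsum l q a + subsum l p a)%nat).
  { clear; induction l; simpl; [reflexivity|]. rewrite IHl; destruct (a l); lia. }
  rewrite E, <- it_nat, Nat2Z.inj_add, it_add, <- dotz_of_nat, it_nat.
  rewrite dist_sym in h2. pose proof (H a _ h2) as h4.
  rewrite dist_sym in h4. rewrite <- it_nat, <- dotz_of_nat in h1.
  eapply Rle_lt_trans; [apply (dist_tri _ (it (dotz l (fun i => Z.of_nat (q i)) a) y))|lra].
Qed.

(** * Generic points *)

Lemma dependent_choice {A : Type} (R : nat -> A -> A -> Prop) (a0 : A) :
  (forall n a, exists b, R n a b) -> exists f, f 0%nat = a0 /\ forall n, R n (f n) (f (S n)).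
Proof.
  intros H.
  exists (nat_rect (fun _ => A) a0 (fun n a => epsilon (inhabits a0) (R n a))).
  split; [reflexivity|]. intros n; simpl. apply epsilon_spec, H.
Qed.

Lemma tail_ultra : exists p : beta nat, forall m, mem p (fun n => (m <= n)%nat).
Proof.
  destruct (ultra_extend (fun A => exists m, A = fun n => (m <= n)%nat)) as [p Hp].
  - exists (fun n => (0 <= n)%nat); eauto.
  - intros A B [m ->] [m' ->]. exists (fun n => (Nat.max m m' <= n)%nat).
    split; [eauto|]. intros a Ha; lia.
  - intros A [m ->]; exists m; lia.
  - exists p; intros m; apply Hp; eauto.
Qed.

(** Compactness stands in for completeness: the centres of the nested balls have a limit along an
    ultrafilter at infinity, and it lies in all the closed balls. *)
Lemma baire (G : nat -> X -> Prop) :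
  (forall n, is_open d (G n)) -> (forall n, dense d (G n)) ->
  dense d (fun x => forall n, G n x).
Proof.
  intros Ho HG x e He.
  destruct (dependent_choice
    (fun n (s s' : {cr : X * R | 0 < snd cr}) =>
       forall y, d (fst (proj1_sig s')) y <= snd (proj1_sig s') ->
         G n y /\ d (fst (proj1_sig s)) y < snd (proj1_sig s))
    (exist _ (x, e) He)) as [f [f0 Hf]].
  - intros n [[c r] Hr]; simpl in *. destruct (HG n c r Hr) as [c' [h1 h2]].
    destruct (Ho n c' h1) as [r1 [Hr1 H1]].
    assert (Hr' : 0 < Rmin (r1/2) ((r - d c c')/2)) by (apply Rmin_pos; lra).
    exists (exist (fun cr => 0 < snd cr) (c', Rmin (r1/2) ((r - d c c')/2)) Hr'); simpl.
    intros y Hy. pose proof (Rmin_l (r1/2) ((r - d c c')/2)).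
    pose proof (Rmin_r (r1/2) ((r - d c c')/2)).
    split; [apply H1; unfold ball; lra|]. pose proof (dist_tri c c' y); lra.
  - set (c := fun n => fst (proj1_sig (f n))). set (r := fun n => snd (proj1_sig (f n))).
    fold c r in Hf.
    assert (Hpos : forall n, 0 < r n) by (intros n; exact (proj2_sig (f n))).
    assert (Hn : forall m n y, (m <= n)%nat -> d (c n) y <= r n -> d (c m) y <= r m).
    { intros m n y H; induction H as [|n H IH]; [auto|]. intros Hy. apply IH.
      apply (Hf n) in Hy. fold (c n) (r n) in Hy. lra. }
    destruct tail_ultra as [p Hp]. set (y := plim p c).
    assert (Hy : forall m, d (c m) y <= r m).
    { intros m. destruct (Rle_lt_dec (d (c m) y) (r m)) as [h|h]; [exact h|exfalso].
      destruct (mem_ex p _ (mem_and p _ _ (Hp m) (tends_plim p c (d (c m) y - r m)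
        ltac:(lra)))) as [n [h1 h2]]. fold y in h2.
      pose proof (Hn m n (c n) h1 ltac:(rewrite dist_self; pose proof (Hpos n); lra)).
      pose proof (dist_tri (c m) (c n) y); lra. }
    exists y; split.
    + intros n. apply (Hf n), (Hy (S n)).
    + destruct (Hf 0%nat y (Hy 1%nat)) as [_ h]. rewrite f0 in h; exact h.
Qed.

Definition generic (k : nat) (x : X) : Prop :=
  forall w, cubeQ k w -> w (fun _ => false) = x ->
  forall e, 0 < e -> exists n, forall a, d (it (dotz k n a) x) (w a) < e.

(* Otherwise some ball contains no [y] as required, and one constructs inside it an infinite
   sequence of cubes that are pairwise at distance at least [e / 2]. *)
Lemma dense_almost_generic k e : 0 < e ->
  dense d (fun x => exists r, 0 < r /\ forall w, cubeQ k w ->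
    d x (w (fun _ => false)) < r ->
    exists n, forall a, d (it (dotz k n a) (w (fun _ => false))) (w a) < e).
Proof.
  intros He x rho Hrho. apply NNPP; intros N.
  set (o := fun _ : nat => false) in *.
  set (inv := fun cr : X * R => 0 < snd cr /\ forall y, d (fst cr) y < snd cr -> d x y < rho).
  destruct (dependent_choice
    (fun _ (s s' : {cr | inv cr} * ((nat -> bool) -> X)) =>
      let '(c, r) := proj1_sig (fst s) in let '(c', r') := proj1_sig (fst s') in
      let w := snd s' in
      cubeQ k w /\ d c (w o) < r /\ (forall y, d c' y < r' -> d c y < r) /\
      (forall n, ~ forall a, d (it (dotz k n a) (w o)) (w a) < e) /\
      forall y, d c' y < r' -> exists n, forall a, d (it (dotz k n a) y) (w a) < e/2)
    (exist inv (x, rho) (conj Hrho (fun y h => h)), fun _ => x)) as [f [_ Hf]].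
  { intros _ [[[c r] [Hr Hc]] w0]; simpl in *.
    assert (Hw : exists w, cubeQ k w /\ d c (w o) < r /\
      forall n, ~ forall a, d (it (dotz k n a) (w o)) (w a) < e).
    { apply NNPP; intros N'. apply N. exists c; split.
      - exists r; split; [exact Hr|]. intros w HQ Hw. apply NNPP; intros N2.
        apply N'. exists w; split; [exact HQ|split; [exact Hw|]]. intros n Hn; apply N2; eauto.
      - apply Hc; now rewrite dist_self. }
    destruct Hw as [w [HQ [Hw Hn]]].
    set (t := Rmin (e/4) (r - d c (w o))).
    pose proof (Rmin_l (e/4) (r - d c (w o))) as t1.
    pose proof (Rmin_r (e/4) (r - d c (w o))) as t2. fold t in t1, t2.
    destruct (HQ t) as [z [n Hz]]; [apply Rmin_pos; lra|].
    destruct (cube_continuous k n (fun _ => z) (e/4)) as [q [Hq Hq']]; [auto|lra|].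
    assert (Hcz : d c z < r).
    { pose proof (Hz o) as h. rewrite dotz_zero in h by (intros [i [_ Hi]]; discriminate).
      simpl in h. rewrite dist_sym in h. pose proof (dist_tri c (w o) z); lra. }
    set (r' := Rmin q (r - d c z)).
    pose proof (Rmin_l q (r - d c z)) as r1.
    pose proof (Rmin_r q (r - d c z)) as r2. fold r' in r1, r2.
    assert (Hsub : forall y, d z y < r' -> d c y < r).
    { intros y Hy. pose proof (dist_tri c z y); lra. }
    assert (Hinv : inv (z, r')).
    { split; simpl; [apply Rmin_pos; lra|]. intros y Hy; apply Hc; auto. }
    exists (exist inv (z, r') Hinv, w); simpl.
    split; [exact HQ|split; [exact Hw|split; [exact Hsub|split; [exact Hn|]]]].
    intros y Hy. exists n; intros a. pose proof (Hq' a y ltac:(lra)) as h1.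
    rewrite dist_sym in h1. pose proof (Hz a) as h2.
    eapply Rle_lt_trans; [apply (dist_tri _ (it (dotz k n a) z))|lra]. }
  set (c := fun i => fst (proj1_sig (fst (f i)))).
  set (r := fun i => snd (proj1_sig (fst (f i)))).
  set (w := fun i => snd (f (S i))).
  assert (Hw : forall i, cubeQ k (w i) /\ d (c i) (w i o) < r i /\
    (forall y, d (c (S i)) y < r (S i) -> d (c i) y < r i) /\
    (forall n, ~ forall a, d (it (dotz k n a) (w i o)) (w i a) < e) /\
    forall y, d (c (S i)) y < r (S i) ->
      exists n, forall a, d (it (dotz k n a) y) (w i a) < e/2).
  { intros i. pose proof (Hf i) as h. unfold c, r, w.
    destruct (proj1_sig (fst (f i))), (proj1_sig (fst (f (S i)))); exact h. }
  assert (Hmon : forall i j y, (i <= j)%nat -> d (c j) y < r j -> d (c i) y < r i).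
  { intros i j y H; induction H as [|j H IH]; [auto|].
    intros Hy; apply IH. now apply (Hw j). }
  destruct tail_ultra as [p Hp].
  assert (Hlim : mem p (fun i => forall a, d (w i a) (plim p (fun i => w i a)) < e/4)).
  { apply mem_bits with (k := k).
    - intros a b i Hab.
      assert (E : forall i, w i a = w i b).
      { intros j. apply (cubeQ_agree k); [apply Hw|exact Hab]. }
      now rewrite E, (plim_ext p _ _ E).
    - intros a. apply tends_plim; lra. }
  (* Two cubes [w i] and [w j] with [i < j] are within [e/2] of each other. The base of [w j] lies
     in the ball of stage [S i], so [w i] is reached from it up to [e/2], and [w j] up to [e],
     against its choice. *)
  destruct (mem_ex p _ Hlim) as [i Hi].
  destruct (mem_ex p _ (mem_and p _ _ Hlim (Hp (S i)))) as [j [Hj Hij]].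
  destruct (proj2 (proj2 (proj2 (proj2 (Hw i)))) (w j o)) as [n Hn].
  { exact (Hmon (S i) j _ Hij (proj1 (proj2 (Hw j)))). }
  apply (proj1 (proj2 (proj2 (proj2 (Hw j)))) n). intros a.
  pose proof (Hn a); pose proof (Hi a) as h1; pose proof (Hj a) as h2; cbv beta in h1, h2.
  rewrite dist_sym in h2.
  pose proof (dist_tri (it (dotz k n a) (w j o)) (w i a) (w j a)).
  pose proof (dist_tri (w i a) (plim p (fun i => w i a)) (w j a)); lra.
Qed.

(** The radius in the condition of [dense_almost_generic] makes it an open one, so [baire] applies
    to it for the scales [/ (INR j + 1)]. *)
Lemma dense_generic k : dense d (generic k).
Proof.
  intros x rho Hrho.
  assert (Hj : forall j : nat, 0 < / (INR j + 1)).
  { intros j. apply Rinv_0_lt_compat. pose proof (pos_INR j); lra. }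
  destruct (baire (fun j x => exists r, 0 < r /\ forall w, cubeQ k w ->
    d x (w (fun _ => false)) < r ->
    exists n, forall a, d (it (dotz k n a) (w (fun _ => false))) (w a) < / (INR j + 1)))
    with (x := x) (e := rho) as [y [Hy Hxy]].
  - intros j y [r [Hr H]]. exists (r/2); split; [lra|]. intros y' Hy'.
    exists (r/2); split; [lra|]. intros w HQ Hw. apply H; [exact HQ|].
    unfold ball in Hy'. pose proof (dist_tri y y' (w (fun _ => false))); lra.
  - intros j. now apply dense_almost_generic.
  - exact Hrho.
  - exists y; split; [|exact Hxy]. intros w HQ Hw e He.
    destruct (archimed_cor1 e He) as [j [Hj1 Hj2]].
    destruct (Hy j) as [r [Hr H]].
    destruct (H w HQ) as [n Hn]; [rewrite Hw; now rewrite dist_self|].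
    exists n; intros a. rewrite <- Hw. apply Rlt_trans with (1 := Hn a).
    apply Rlt_trans with (/ INR j); [|exact Hj1].
    apply Rinv_lt_contravar; [|lra]. apply lt_0_INR in Hj2. nra.
Qed.

(** * Replacing vertices of cubes over generic points *)

Definition xorv (v a : nat -> bool) : nat -> bool := fun i => xorb (v i) (a i).

Lemma dotz_xorv k n v a : dotz k n (xorv v a) =
  (dotz k n v + dotz k (fun i => if v i then - n i else n i) a)%Z.
Proof.
  induction k as [|k IH]; simpl; [reflexivity|]. rewrite IH. unfold xorv.
  destruct (v k), (a k); simpl; lia.
Qed.

(** Rebasing at the vertex [v]: the base point moves along [dotz k n v], and the coordinates
    selected by [v] change sign. *)
Lemma cubeQ_flip k v w : cubeQ k w -> cubeQ k (fun a => w (xorv v a)).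
Proof.
  intros HQ e He. destruct (HQ e He) as [z [n H]].
  exists (it (dotz k n v) z), (fun i => if v i then - n i else n i)%Z; intros a.
  rewrite <- it_add, Z.add_comm, <- dotz_xorv. apply H.
Qed.

(** As [x] is generic, some [n] moves the constant cube [x] close to [w]. By symmetry of [RPinf],
    [y] comes near [x] along a finite IP-set [p]. Starting at [y] with [n + p] gives [w] at the
    nonzero vertices, while the base stays [y]. *)
Lemma cubeQ_change_base k x y w : generic k x -> RPinf d T Ti x y -> cubeQ k w ->
  w (fun _ => false) = x ->
  cubeQ k (fun a => if excluded_middle_informative (nonzero k a) then w a else y).
Proof.
  intros Hx Hxy HQ Hw e He.
  destruct (Hx w HQ Hw (e/2) ltac:(lra)) as [n Hn].
  destruct (cube_continuous k n (fun _ => x) (e/2)) as [r [Hr H]]; [auto|lra|].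
  destruct (RPinf_fip y x r k (RPinf_sym x y Hxy) Hr) as [p [_ Hp]].
  exists y, (addv n (fun i => Z.of_nat (p i))); intros a.
  destruct (excluded_middle_informative (nonzero k a)) as [Ha|Ha].
  - specialize (Hp a Ha). rewrite dist_sym, <- it_nat, <- dotz_of_nat in Hp.
    apply (H a) in Hp. rewrite dist_sym in Hp. rewrite dotz_addv, it_add.
    pose proof (Hn a).
    eapply Rle_lt_trans; [apply (dist_tri _ (it (dotz k n a) x))|lra].
  - rewrite dotz_zero by exact Ha. simpl. now rewrite dist_self.
Qed.

Lemma cubeQ_change_vertex k x y w v : generic k x -> RPinf d T Ti x y -> cubeQ k w ->
  w v = x ->
  cubeQ k (fun a => if excluded_middle_informative (agree k v a) then y else w a).
Proof.
  intros Hx Hxy HQ Hw.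
  pose proof (cubeQ_flip k v _ (cubeQ_change_base k x y (fun a => w (xorv v a)) Hx Hxy
    (cubeQ_flip k v w HQ) ltac:(rewrite <- Hw; apply (cubeQ_agree k w _ _ HQ);
      intros i _; unfold xorv; now destruct (v i)))) as H.
  intros e He. destruct (H e He) as [z [n Hn]]. exists z, n; intros a.
  specialize (Hn a); cbv beta in Hn.
  destruct (excluded_middle_informative (nonzero k (xorv v a))) as [h|h];
  destruct (excluded_middle_informative (agree k v a)) as [h'|h'].
  - exfalso. destruct h as [i [Hi Ha]]. unfold xorv in Ha. rewrite (h' i Hi) in Ha.
    now destruct (a i).
  - rewrite (cubeQ_agree k w a (xorv v (xorv v a)) HQ); [exact Hn|].
    intros i _; unfold xorv; now destruct (v i), (a i).
  - exact Hn.
  - exfalso. apply h'. intros i Hi. destruct (Bool.bool_dec (v i) (a i)) as [E|E]; [exact E|].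
    exfalso. apply h. exists i; split; [exact Hi|]. unfold xorv.
    now destruct (v i), (a i).
Qed.

Lemma finite_bits k : forall P : (nat -> bool) -> Prop,
  (forall a b, agree k a b -> P a -> P b) ->
  exists l, forall a, P a <-> exists v, In v l /\ agree k v a.
Proof.
  induction k as [|k IH]; intros P HP.
  - destruct (classic (P (fun _ => false))) as [h|h].
    + exists (cons (fun _ => false) nil). intros a; split.
      * intros _. exists (fun _ => false); split; [now left|intros i Hi; lia].
      * intros _. apply (HP (fun _ => false)); [intros i Hi; lia|exact h].
    + exists nil. intros a; split; [|intros [v [[] _]]].
      intros Ha; exfalso; apply h. apply (HP a); [intros i Hi; lia|exact Ha].
  - assert (Hb : forall b, exists l, forall a, P (setv a k b) <-> exists v, In v l /\ agree k v a).
    { intros b; apply IH. intros u v Huv. apply HP. now apply agree_setv. }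
    destruct (Hb false) as [l0 H0], (Hb true) as [l1 H1].
    exists (map (fun v => setv v k false) l0 ++ map (fun v => setv v k true) l1)%list.
    assert (Hs : forall b l a, (exists v, In v (map (fun v => setv v k b) l) /\ agree (S k) v a) <->
      b = a k /\ exists v, In v l /\ agree k v a).
    { intros b l a; split.
      - intros [v [Hv Hva]]. apply in_map_iff in Hv. destruct Hv as [u [<- Hu]].
        split; [rewrite <- (Hva k) by lia; now rewrite setv_eq|].
        exists u; split; [exact Hu|]. intros i Hi. rewrite <- (Hva i) by lia.
        rewrite setv_neq by lia; reflexivity.
      - intros [Hb' [v [Hv Hva]]]. exists (setv v k b).
        split; [now apply (in_map (fun v => setv v k b))|].
        intros i Hi. destruct (Nat.eq_dec i k) as [->|N]; [now rewrite setv_eq|].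
        rewrite setv_neq by lia. apply Hva; lia. }
    assert (HPa : forall a, P a <-> P (setv a k (a k))).
    { intros a; split; apply HP; [|now apply setv_same].
      intros i Hi; symmetry; now apply (setv_same k a _ eq_refl). }
    intros a; rewrite HPa. destruct (a k) eqn:Ha.
    + rewrite H1; split.
      * intros h. destruct (proj2 (Hs true l1 a) (conj (eq_sym Ha) h)) as [v [h1 h2]].
        exists v; split; [apply in_or_app; now right|exact h2].
      * intros [v [h1 h2]]. apply in_app_or in h1. destruct h1 as [h1|h1].
        -- destruct (proj1 (Hs false l0 a) (ex_intro _ v (conj h1 h2))); congruence.
        -- now apply (Hs true l1 a); exists v.
    + rewrite H0; split.
      * intros h. destruct (proj2 (Hs false l0 a) (conj (eq_sym Ha) h)) as [v [h1 h2]].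
        exists v; split; [apply in_or_app; now left|exact h2].
      * intros [v [h1 h2]]. apply in_app_or in h1. destruct h1 as [h1|h1].
        -- now apply (Hs false l0 a); exists v.
        -- destruct (proj1 (Hs true l1 a) (ex_intro _ v (conj h1 h2))); congruence.
Qed.

Tactic Notation "split_if" "as" simple_intropattern(p) :=
  match goal with |- context [excluded_middle_informative ?P] =>
    destruct (excluded_middle_informative P) as p end.

Tactic Notation "split_if" "in" hyp(h) "as" simple_intropattern(p) :=
  match type of h with context [excluded_middle_informative ?P] =>
    destruct (excluded_middle_informative P) as p in h end.

(** The vertices of [P] are replaced one at a time, each still carrying [x] when its turn comes. *)
Lemma cubeQ_pattern k x y (P : (nat -> bool) -> Prop) :
  generic k x -> RPinf d T Ti x y -> (forall a b, agree k a b -> P a -> P b) ->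
  cubeQ k (fun a => if excluded_middle_informative (P a) then y else x).
Proof.
  intros Hx Hxy HP. destruct (finite_bits k P HP) as [l Hl].
  assert (H : forall l, cubeQ k (fun a =>
    if excluded_middle_informative (exists v, In v l /\ agree k v a) then y else x)).
  { clear l Hl. intros l; induction l as [|v l IH].
    - intros e He. destruct (cubeQ_const k x e He) as [z [n H]]. exists z, n; intros a.
      split_if as [[v [[] _]]|_]. apply H.
    (* A vertex that occurs in the tail of the list already carries [y]. *)
    - destruct (classic (exists v', In v' l /\ agree k v' v)) as [[v' [h1 h2]]|h].
      + intros e He. destruct (IH e He) as [z [n H]]. exists z, n; intros a.
        specialize (H a). cbv beta in H.
        split_if in H as [h|h];
        split_if as [h'|h']; auto; exfalso.
        * apply h'. destruct h as [u [hu hu']]. exists u; split; [now right|exact hu'].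
        * apply h. destruct h' as [u [[<-|hu] hu']]; [|eauto].
          exists v'; split; [exact h1|]. intros i Hi. rewrite (h2 i Hi); auto.
      + pose proof (cubeQ_change_vertex k x y _ v Hx Hxy IH) as H.
        assert (Hv : (if excluded_middle_informative (exists u, In u l /\ agree k u v)
          then y else x) = x) by (destruct (excluded_middle_informative _); tauto).
        specialize (H Hv). intros e He. destruct (H e He) as [z [n Hn]].
        exists z, n; intros a. specialize (Hn a). cbv beta in Hn.
        destruct (excluded_middle_informative (agree k v a)) as [h1|h1].
        * split_if as [_|h2]; [exact Hn|].
          exfalso; apply h2. exists v; split; [now left|exact h1].
        * split_if in Hn as [h2|h2];
          split_if as [h3|h3]; auto; exfalso.
          -- apply h3. destruct h2 as [u [hu hu']]. exists u; split; [now right|exact hu'].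
          -- destruct h3 as [u [[<-|hu] hu']]; [contradiction|eauto]. }
  intros e He. destruct (H l e He) as [z [n Hn]]. exists z, n; intros a. specialize (Hn a).
  cbv beta in Hn.
  split_if in Hn as [h|h];
  split_if as [h'|h']; auto; exfalso.
  - apply h', Hl, h.
  - apply h, Hl, h'.
Qed.

Lemma fibers_separate delta l x rho : 0 < delta ->
  (forall x, exists y, RPinf d T Ti x y /\ d x y >= delta) -> 0 < rho ->
  exists x' y', d x x' < rho /\ d x y' < rho /\
    contains_fip (fun n => d (Nat.iter n T x') (Nat.iter n T y') > delta/2) l.
Proof.
  intros Hdelta H3 Hrho.
  destruct (dense_generic (S l) x (rho/2) ltac:(lra)) as [g [Hg Hxg]].
  destruct (H3 g) as [y [Hy Hgy]].
  set (P := fun a : nat -> bool => nonzero l a /\ a l = false).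
  assert (HP : forall a b, agree (S l) a b -> P a -> P b).
  { intros a b Hab [h1 h2]. split; [|rewrite <- Hab; [exact h2|lia]].
    apply (nonzero_agree l a b); [intros i Hi; apply Hab; lia|exact h1]. }
  (* At the chosen times one point is within [2 * e] of [y] and the other within [2 * e] of [g]; as
     [d g y] is at least [delta], more than [delta/2] remains. *)
  set (e := Rmin (rho/2) (delta/16)).
  pose proof (Rmin_l (rho/2) (delta/16)) as e1. pose proof (Rmin_r (rho/2) (delta/16)) as e2.
  fold e in e1, e2. assert (He : 0 < e) by (apply Rmin_pos; lra).
  destruct (cubeQ_pattern (S l) g y P Hg Hy HP e He) as [z [n Hn]].
  assert (Hlow : forall a, nonzero l a -> d (it (dotz l n a) z) y < e).
  { intros a Ha. pose proof (Hn (setv a l false)) as h.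
    rewrite dotz_S_setv, Z.add_0_r in h.
    split_if in h as [_|N]; [exact h|exfalso; apply N].
    split; [|apply setv_eq]. apply (nonzero_agree l a); [|exact Ha].
    intros i Hi; symmetry; now apply setv_agree. }
  assert (Hup : forall a, d (it (dotz l n a) (it (n l) z)) g < e).
  { intros a. pose proof (Hn (setv a l true)) as h.
    rewrite dotz_S_setv, it_add in h.
    split_if in h as [[_ N]|_]; [|exact h].
    rewrite setv_eq in N; discriminate. }
  assert (Hz : d z g < e).
  { pose proof (Hn (fun _ => false)) as h.
    rewrite dotz_zero in h by (intros [i [_ Hi]]; discriminate).
    split_if in h as [[[i [_ Hi]] _]|_];
      [discriminate|exact h]. }
  destruct (cube_positive l z n (n l) e He) as [p [Hp Hp']].
  (* The bases of the lower and the upper face: both vertices carry [g], so both points are close to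
     [x]. *)
  exists z, (it (n l) z). split; [|split].
  - pose proof (dist_tri x g z). rewrite (dist_sym g z) in H. lra.
  - pose proof (Hup (fun _ => false)) as h.
    rewrite dotz_zero in h by (intros [i [_ Hi]]; discriminate). simpl in h.
    pose proof (dist_tri x g (it (n l) z)). rewrite (dist_sym g) in H. lra.
  - exists p; split; [exact Hp|]. intros a Ha. rewrite <- !it_nat.
    set (s := Z.of_nat (subsum l p a)) in *.
    destruct (Hp' a) as [h1 h2]. fold s in h1, h2.
    pose proof (Hlow a Ha) as h3. pose proof (Hup a) as h4.
    pose proof (dist_tri g (it s (it (n l) z)) y) as t1.
    pose proof (dist_tri (it s (it (n l) z)) (it s z) y) as t2.
    pose proof (dist_tri (it s z) (it (dotz l n a) z) y) as t3.
    pose proof (dist_tri (it s (it (n l) z)) (it (dotz l n a) (it (n l) z)) g) as t4.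
    rewrite (dist_sym g (it s (it (n l) z))) in t1.
    rewrite (dist_sym (it s (it (n l) z)) (it s z)) in t2. lra.
Qed.

(** * Folkman's theorem and sensitivity *)

Definition orv (a b : nat -> bool) : nat -> bool := fun i => orb (a i) (b i).

Definition fin_above (m : nat) (a : nat -> bool) : Prop :=
  (exists i, a i = true) /\ (exists N, forall i, (N <= i)%nat -> a i = false) /\
  forall i, (i < m)%nat -> a i = false.

Lemma orv_assoc a b c : orv a (orv b c) = orv (orv a b) c.
Proof. apply functional_extensionality; intros i; unfold orv; now destruct (a i), (b i). Qed.

Lemma fin_above_orv m a b : fin_above m a -> fin_above m b -> fin_above m (orv a b).
Proof.
  intros [[i Hi] [[N HN] Ha]] [_ [[N' HN'] Hb]]. unfold orv. split; [|split].
  - exists i; now rewrite Hi.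
  - exists (Nat.max N N'); intros j Hj. rewrite HN, HN' by lia; reflexivity.
  - intros j Hj. now rewrite Ha, Hb.
Qed.

(** Bit vectors now stand for finite subsets of [nat]. Concentration on sets beyond every [m] will
    allow disjoint choices. *)
Lemma union_idempotent : exists p : beta (nat -> bool),
  mulb orv p p = p /\ forall m, mem p (fin_above m).
Proof.
  destruct (ellis orv orv_assoc (fun p => forall m, mem p (fin_above m))) as [p [h1 h2]].
  - apply closedb_forall; intros m; apply closedb_basic.
  - destruct (ultra_extend (fun A => exists m, A = fin_above m)) as [p Hp].
    + exists (fin_above 0); eauto.
    + intros A B [m ->] [m' ->]. exists (fin_above (Nat.max m m')). split; [eauto|].
      intros a [h1 [h2 h3]]; split; (split; [exact h1|split; [exact h2|]]); intros i Hi;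
      apply h3; lia.
    + intros A [m ->]. exists (setv (fun _ => false) m true). split; [|split].
      * exists m; apply setv_eq.
      * exists (S m); intros i Hi; rewrite setv_neq; [reflexivity|lia].
      * intros i Hi; rewrite setv_neq; [reflexivity|lia].
    + exists p; intros m; apply Hp; eauto.
  - intros p q Hp Hq m. simpl. apply (mem_mono p _ _ (Hp m)); intros a Ha.
    apply (mem_mono q _ _ (Hq m)); intros b Hb. now apply fin_above_orv.
  - exists p; auto.
Qed.

Fixpoint union (l : nat) (b : nat -> nat -> bool) (a : nat -> bool) : nat -> bool :=
  match l with
  | O => fun _ => false
  | S k => orv (union k b a) (if a k then b k else fun _ => false)
  end.

Lemma union_agree l b a a' : agree l a a' -> union l b a = union l b a'.
Proof.
  induction l as [|l IH]; intros H; simpl; [reflexivity|].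
  rewrite IH, (H l); [reflexivity|lia|]. intros i Hi; apply H; lia.
Qed.

Lemma union_setv l b c a : union l (setv b l c) a = union l b a.
Proof.
  enough (H : forall k, (k <= l)%nat -> union k (setv b l c) a = union k b a) by now apply H.
  induction k as [|k IH]; intros Hk; simpl; [reflexivity|].
  rewrite IH, setv_neq by lia. reflexivity.
Qed.

Lemma subsum_orv k p a b : (forall i, (i < k)%nat -> a i = true -> b i = false) ->
  subsum k p (orv a b) = (subsum k p a + subsum k p b)%nat.
Proof.
  induction k as [|k IH]; intros H; simpl; [reflexivity|].
  rewrite IH by (intros i Hi; apply H; lia). specialize (H k ltac:(lia)).
  unfold orv; destruct (a k), (b k); simpl; try lia; discriminate (H eq_refl).
Qed.

Lemma subsum_pos k p a : (forall i, (i < k)%nat -> (1 <= p i)%nat) -> nonzero k a ->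
  (1 <= subsum k p a)%nat.
Proof.
  intros Hp; induction k as [|k IH]; intros [i [Hi Ha]]; [lia|]. simpl.
  destruct (Nat.eq_dec i k) as [->|N].
  - rewrite Ha. specialize (Hp k ltac:(lia)); lia.
  - assert (1 <= subsum k p a)%nat; [|lia].
    apply IH; [intros j Hj; apply Hp; lia|exists i; split; [lia|exact Ha]].
Qed.

Section Unions.
Context (p : beta (nat -> bool)) (Hpp : mulb orv p p = p)
  (Hfin : forall m, mem p (fin_above m)).

(** Idempotence lets an admissible extension be chosen so that it can itself be extended further. *)
Lemma idempotent_star (A : (nat -> bool) -> Prop) a :
  mem p (fun b => A (orv a b)) ->
  mem p (fun b => A (orv a b) /\ mem p (fun c => A (orv (orv a b) c))).
Proof.
  intros H. apply mem_and; [exact H|].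
  rewrite <- Hpp in H; simpl in H. apply (mem_mono p _ _ H); intros b h.
  apply (mem_mono p _ _ h); intros c; now rewrite orv_assoc.
Qed.

(** Galvin-Glazer induction. The invariant is that every union built so far, the empty one included,
    extends within [A] by [p]-most sets. The next set is taken beyond the bound [N] of all earlier
    ones, so the blocks are disjoint and sums over unions split. *)
Lemma idempotent_unions (A : (nat -> bool) -> Prop) l : mem p A ->
  exists b N, (forall a, nonzero l a -> A (union l b a)) /\
    (forall a i, (N <= i)%nat -> union l b a i = false) /\
    (forall i, (i < l)%nat -> nonzero N (b i)) /\
    forall k q a, subsum k q (union l b a) = subsum l (fun i => subsum k q (b i)) a.
Proof.
  intros HA.
  enough (H : exists b N,
    (forall a, nonzero l a -> A (union l b a)) /\
    (forall a, mem p (fun c => A (orv (union l b a) c))) /\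
    (forall a i, (N <= i)%nat -> union l b a i = false) /\
    (forall i, (i < l)%nat -> nonzero N (b i)) /\
    forall k q a, subsum k q (union l b a) = subsum l (fun i => subsum k q (b i)) a).
  { destruct H as [b [N [h1 [_ h2]]]]; eauto. }
  induction l as [|l [b [N [H1 [H2 [H3 [H4 H5]]]]]]].
  - exists (fun _ _ => false), 0%nat. split; [|split; [|split; [|split]]].
    + intros a [i [Hi _]]; lia.
    + intros a; exact HA.
    + reflexivity.
    + intros i Hi; lia.
    + intros k q a; simpl. apply subsum_zero.
  - destruct (mem_ex p (fun c => fin_above N c /\ forall a, A (orv (union l b a) c) /\
      mem p (fun c' => A (orv (orv (union l b a) c) c')))) as [c [[Hc1 [[N' HN'] Hc3]] Hc]].
    { apply mem_and; [apply Hfin|]. apply mem_bits with (k := l).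
      - intros a a' c Ha. now rewrite (union_agree l b a a' Ha).
      - intros a. apply idempotent_star, H2. }
    assert (E : forall a, union (S l) (setv b l c) a =
      if a l then orv (union l b a) c else union l b a).
    { intros a; simpl. rewrite union_setv, setv_eq. destruct (a l); [reflexivity|].
      apply functional_extensionality; intros i; unfold orv; apply Bool.orb_false_r. }
    exists (setv b l c), (Nat.max N N'). split; [|split; [|split; [|split]]].
    + intros a [i [Hi Ha]]. rewrite E. destruct (a l) eqn:Hal; [apply Hc|].
      apply H1. exists i; split; [|exact Ha]. destruct (Nat.eq_dec i l); [congruence|lia].
    + intros a. rewrite E. destruct (a l); [apply Hc|apply H2].
    + intros a i Hi. rewrite E. destruct (a l); [unfold orv; rewrite HN' by lia|];
      rewrite H3 by lia; reflexivity.
    + intros i Hi. destruct (Nat.eq_dec i l) as [->|Hil].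
      * rewrite setv_eq. destruct Hc1 as [j Hj]. exists j; split; [|exact Hj].
        destruct (le_lt_dec N' j) as [h|h]; [rewrite HN' in Hj by exact h; discriminate|lia].
      * rewrite setv_neq by exact Hil. destruct (H4 i ltac:(lia)) as [j [h1 h2]].
        exists j; split; [lia|exact h2].
    + intros k q a. rewrite E. simpl. rewrite setv_eq.
      assert (E' : subsum l (fun i => subsum k q (setv b l c i)) a = subsum k q (union l b a)).
      { rewrite H5. enough (H : forall j, (j <= l)%nat ->
          subsum j (fun i => subsum k q (setv b l c i)) a =
          subsum j (fun i => subsum k q (b i)) a) by now apply H.
        induction j as [|j IH]; intros Hj; simpl; [reflexivity|].
        rewrite IH, setv_neq by lia; reflexivity. }
      rewrite E'. destruct (a l); [|lia]. apply subsum_orv. intros i _ Hi.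
      apply Hc3. destruct (le_lt_dec N i) as [h|h]; [|exact h].
      rewrite H3 in Hi by exact h; discriminate.
Qed.

(** Folkman's theorem for a sequence of IP-systems [P k] of growing length: the blocks [b] are found
    once, for the property of being good for [u]-most [k], and then serve for [u]-most [k]
    simultaneously. *)
Lemma fip_transfer (u : beta nat) (P : nat -> nat -> nat) (Good : nat -> nat -> Prop) l :
  (forall m, mem u (fun k => (m <= k)%nat)) ->
  (forall k i, (i < k)%nat -> (1 <= P k i)%nat) ->
  mem p (fun a => mem u (fun k => Good k (subsum k (P k) a))) ->
  mem u (fun k => contains_fip (Good k) l).
Proof.
  intros Hu HP H. destruct (idempotent_unions _ l H) as [b [N [H1 [_ [H3 H4]]]]].
  assert (H5 : mem u (fun k => forall a, nonzero l a -> Good k (subsum k (P k) (union l b a)))).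
  { apply mem_bits with (k := l).
    - intros a a' k Ha h Ha'. rewrite <- (union_agree l b a a' Ha). apply h.
      apply (nonzero_agree l a' a); [intros i Hi; symmetry; auto|exact Ha'].
    - intros a. destruct (classic (nonzero l a)) as [h|h].
      + apply (mem_mono u _ _ (H1 a h)); auto.
      + apply mem_all; intros k h'; contradiction. }
  (* For [k] at least [N] the blocks fit into the first [k] generators, which makes their sums
     positive. *)
  apply (mem_mono u _ _ (mem_and u _ _ H5 (Hu N))). intros k [h1 h2].
  exists (fun i => subsum k (P k) (b i)). split.
  - intros i Hi. apply subsum_pos; [apply HP|]. destruct (H3 i Hi) as [j [hj hj']].
    exists j; split; [lia|exact hj'].
  - intros a Ha. rewrite <- H4. now apply h1.
Qed.

End Unions.

(** * Local separation and regionally proximal pairs *)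

Definition separated (c : R) (x y : X) (n : nat) : Prop :=
  d (Nat.iter n T x) (Nat.iter n T y) > c.

(** The condition through which (1), (2) and (3) are linked: each implies it for some positive [c]
    and follows from it. The length [l] is fixed before the two points. *)
Definition locally_separated (c : R) : Prop :=
  forall l x rho, 0 < rho -> exists x' y', d x x' < rho /\ d x y' < rho /\
    contains_fip (separated c x' y') l.

Lemma fip_eventually (u : beta nat) (P : nat -> nat -> nat) (A : nat -> nat -> Prop) a :
  (forall m, mem u (fun k => (m <= k)%nat)) -> fin_above 0 a ->
  (forall k b, nonzero k b -> A k (subsum k (P k) b)) ->
  mem u (fun k => A k (subsum k (P k) a)).
Proof.
  intros Hu [[i Hi] _] H. apply (mem_mono u _ _ (Hu (S i))). intros k Hk.
  apply H. exists i; split; [lia|exact Hi].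
Qed.

(** When two points are more than [c] apart, the orbit of [x] is at that time more than [c/2] from
    one of them. This colours the sums in two colours, and the idempotent selects one that occurs
    along finite IP-sets of length [l]. *)
Lemma locally_separated_dense c x l : locally_separated c ->
  dense d (fun y => contains_fip (separated (c/2) x y) l).
Proof.
  intros H x0 rho Hrho.
  destruct (functional_choice (fun k (t : X * X * (nat -> nat)) =>
    d x0 (fst (fst t)) < rho /\ d x0 (snd (fst t)) < rho /\
    (forall i, (i < k)%nat -> (1 <= snd t i)%nat) /\
    forall a, nonzero k a -> separated c (fst (fst t)) (snd (fst t)) (subsum k (snd t) a)))
    as [t Ht].
  { intros k. destruct (H k x0 rho Hrho) as [x' [y' [h1 [h2 [p [h3 h4]]]]]].
    exists (x', y', p); auto. }
  destruct union_idempotent as [p [Hpp Hp]]. destruct tail_ultra as [u Hu].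
  set (P := fun k => snd (t k)).
  assert (HP : forall k i, (i < k)%nat -> (1 <= P k i)%nat) by (intros k; apply (Ht k)).
  set (G := fun (f : X * X -> X) k n => separated (c/2) x (f (fst (t k))) n).
  assert (Hor : mem p (fun a => mem u (fun k => G fst k (subsum k (P k) a)) \/
    mem u (fun k => G snd k (subsum k (P k) a)))).
  { apply (mem_mono p _ _ (Hp 0%nat)); intros a Ha. apply mem_or.
    apply (mem_mono u _ _ (fip_eventually u P
      (fun k n => separated c (fst (fst (t k))) (snd (fst (t k))) n) a Hu Ha
      ltac:(intros k; apply (Ht k)))).
    intros k. unfold G, separated. set (n := subsum k (P k) a). intros h.
    pose proof (dist_tri (Nat.iter n T (fst (fst (t k)))) (Nat.iter n T x)
      (Nat.iter n T (snd (fst (t k))))) as h1.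
    rewrite (dist_sym _ (Nat.iter n T x)) in h1.
    destruct (Rlt_le_dec (c/2) (d (Nat.iter n T x) (Nat.iter n T (fst (fst (t k))))));
      [left|right]; lra. }
  destruct (mem_or p _ _ Hor) as [h|h];
  destruct (mem_ex u _ (fip_transfer p Hpp Hp u P _ l Hu HP h)) as [k Hk];
  eexists; split; try exact Hk; apply (Ht k).
Qed.

Lemma separated_fip_open c x l : is_open d (fun y => contains_fip (separated c x y) l).
Proof.
  intros y [p [Hp H]].
  destruct (bits_uniform (fun A : X -> Prop => exists r, 0 < r /\ forall z, d y z < r -> A z))
    with (k := l) (P := fun a z => nonzero l a -> separated c x z (subsum l p a))
    as [r [Hr H']].
  - intros A B [r [Hr HA]] [s [Hs HB]]. exists (Rmin r s); split; [now apply Rmin_pos|].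
    intros z Hz. pose proof (Rmin_l r s); pose proof (Rmin_r r s).
    split; [apply HA|apply HB]; lra.
  - intros A B [r [Hr HA]] HAB. exists r; auto.
  - intros a b z Hab h Hb.
    assert (E : Z.of_nat (subsum l p a) = Z.of_nat (subsum l p b)).
    { rewrite <- !dotz_of_nat. now apply dotz_agree. }
    apply Nat2Z.inj in E. rewrite <- E. apply h.
    apply (nonzero_agree l b a); [intros i Hi; symmetry; auto|exact Hb].
  - intros a. destruct (classic (nonzero l a)) as [Ha|Ha].
    + specialize (H a Ha). unfold separated in *. set (n := subsum l p a) in *.
      destruct (it_continuous (Z.of_nat n) y (d (Nat.iter n T x) (Nat.iter n T y) - c))
        as [r [Hr h]]; [lra|].
      exists r; split; [exact Hr|]. intros z Hz _. specialize (h z Hz).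
      rewrite !it_nat in h.
      pose proof (dist_tri (Nat.iter n T x) (Nat.iter n T z) (Nat.iter n T y)) as h1.
      rewrite (dist_sym (Nat.iter n T z)) in h1. lra.
    + exists 1; split; [lra|]. intros z _ h; contradiction.
  - exists r; split; [exact Hr|]. intros z Hz. exists p; split; [exact Hp|].
    intros a; now apply (H' z Hz).
Qed.

Lemma locally_separated_everywhere c x : locally_separated c ->
  dense d (fun y => forall l, contains_fip (separated (c/2) x y) l).
Proof.
  intros H. apply baire; intros l; [apply separated_fip_open|now apply locally_separated_dense].
Qed.

(** Points [f k] converging to [x] are separated from [x] along IP-systems of length [k]. Limits of
    the orbits of [x] and of [f k] along these sums, first over [k] and then over the idempotent,
    are two points in the class of [x] at distance at least [c/2]; one of them is at least [c/4]
    from [x]. *)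
Lemma locally_separated_fibers c x : locally_separated c ->
  exists y, RPinf d T Ti x y /\ d x y >= c/4.
Proof.
  intros H.
  assert (Hk : forall k : nat, 0 < / (INR k + 1)).
  { intros k. apply Rinv_0_lt_compat. pose proof (pos_INR k); lra. }
  destruct (functional_choice (fun k (t : X * (nat -> nat)) =>
    d x (fst t) < / (INR k + 1) /\ (forall i, (i < k)%nat -> (1 <= snd t i)%nat) /\
    forall a, nonzero k a -> separated (c/2) x (fst t) (subsum k (snd t) a))) as [t Ht].
  { intros k. destruct (locally_separated_everywhere c x H x _ (Hk k)) as [y [h1 h2]].
    destruct (h1 k) as [p [h3 h4]]. exists (y, p); auto. }
  destruct union_idempotent as [p [Hpp Hp]]. destruct tail_ultra as [u Hu].
  set (P := fun k => snd (t k)).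
  assert (HP : forall k i, (i < k)%nat -> (1 <= P k i)%nat) by (intros k; apply (Ht k)).
  set (val := fun (f : nat -> X) a => plim u (fun k => Nat.iter (subsum k (P k) a) T (f k))).
  assert (HR : forall f, (forall e, 0 < e -> mem u (fun k => d x (f k) < e)) ->
    RPinf d T Ti x (plim p (val f))).
  { intros f Hf. apply RPinf_of_fip. intros e l He.
    assert (Hm : mem p (fun a => mem u (fun k =>
      d (Nat.iter (subsum k (P k) a) T (f k)) (plim p (val f)) < e))).
    { apply (mem_mono p _ _ (tends_plim p (val f) (e/2) ltac:(lra))). intros a Ha.
      apply (mem_mono u _ _ (tends_plim u
        (fun k => Nat.iter (subsum k (P k) a) T (f k)) (e/2) ltac:(lra))).
      intros k h. fold (val f a) in h.
      eapply Rle_lt_trans; [apply (dist_tri _ (val f a))|lra]. }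
    pose proof (fip_transfer p Hpp Hp u P
      (fun k n => d (Nat.iter n T (f k)) (plim p (val f)) < e) l Hu HP Hm) as Hm'.
    destruct (mem_ex u _ (mem_and u _ _ (Hf e He) Hm')) as [k [h1 h2]].
    exists (f k); auto. }
  set (f := fun k => fst (t k)).
  assert (H1 : RPinf d T Ti x (plim p (val (fun _ => x)))).
  { apply HR. intros e He. apply mem_const. now rewrite dist_self. }
  assert (H2 : RPinf d T Ti x (plim p (val f))).
  { apply HR. intros e He. destruct (archimed_cor1 e He) as [N [hN hN']].
    apply (mem_mono u _ _ (Hu N)). intros k Hk'.
    apply Rlt_trans with (1 := proj1 (Ht k)). apply Rlt_trans with (2 := hN).
    apply lt_0_INR in hN'. apply le_INR in Hk'.
    apply Rinv_lt_contravar; [apply Rmult_lt_0_compat; lra|lra]. }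
  assert (H3 : d (plim p (val (fun _ => x))) (plim p (val f)) >= c/2).
  { apply plim_dist_ge. apply (mem_mono p _ _ (Hp 0%nat)). intros a Ha.
    apply plim_dist_ge.
    apply (mem_mono u _ _ (fip_eventually u P (fun k n => separated (c/2) x (f k) n) a Hu Ha
      ltac:(intros k; apply (Ht k)))).
    intros k h. unfold separated in h. lra. }
  pose proof (dist_tri (plim p (val (fun _ => x))) x (plim p (val f))) as h.
  rewrite (dist_sym _ x) in h.
  destruct (Rlt_le_dec (d x (plim p (val f))) (c/4)); [|exists (plim p (val f)); split; auto; lra].
  exists (plim p (val (fun _ => x))); split; [exact H1|lra].
Qed.

(** * Fibers *)

Lemma RPinf_it k x y : RPinf d T Ti x y -> RPinf d T Ti (it k x) (it k y).
Proof.
  intros H. apply RPinf_of_fip. intros e l He. exists (it k x).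
  split; [now rewrite dist_self|].
  destruct (it_continuous k y e He) as [r [Hr Hc]].
  apply (fip_mono (fun n => d (Nat.iter n T x) y < r)); [|now apply RPinf_fip].
  intros n Hn. rewrite <- !it_nat, it_comm. rewrite dist_sym; apply Hc.
  now rewrite dist_sym, it_nat.
Qed.

Lemma RPinf_closed x y :
  (forall e, 0 < e -> exists x' y', d x x' < e /\ d y y' < e /\ RPinf d T Ti x' y') ->
  RPinf d T Ti x y.
Proof.
  intros H k Hk e He. destruct (H (e/2) ltac:(lra)) as [x' [y' [h1 [h2 h3]]]].
  destruct (h3 k Hk (e/2) ltac:(lra)) as [x2 [y2 [n [h4 [h5 h6]]]]].
  exists x2, y2, n. split; [|split].
  - pose proof (dist_tri x x' x2); lra.
  - pose proof (dist_tri y y' y2); lra.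
  - intros a Ha. apply Rlt_trans with (1 := h6 a Ha); lra.
Qed.

(** Since the relation is closed and [X] compact, large fibres near [x] would accumulate at a large
    fibre of [x]. *)
Lemma small_fiber_open c : is_open d (fun x => forall y, RPinf d T Ti x y -> d x y < c).
Proof.
  intros x Hx. apply NNPP; intros N.
  destruct (beta_decreasing (fun e (xy : X * X) => d x (fst xy) < e /\
    RPinf d T Ti (fst xy) (snd xy) /\ d (fst xy) (snd xy) >= c)) as [p Hp].
  - intros e He. apply NNPP; intros N'. apply N. exists e; split; [exact He|].
    intros x' Hx' y Hy. destruct (Rlt_le_dec (d x' y) c) as [h|h]; [exact h|].
    exfalso; apply N'. exists (x', y); simpl. split; [exact Hx'|split; [exact Hy|lra]].
  - intros e e' xy He [h1 h2]; split; [lra|exact h2].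
  - assert (E : plim p fst = x).
    { apply plim_eq; intros e He. apply (mem_mono p _ _ (Hp e He)).
      intros xy [h _]. now rewrite dist_sym. }
    assert (Hd' : d x (plim p snd) >= c).
    { rewrite <- E. apply plim_dist_ge. apply (mem_mono p _ _ (Hp 1 ltac:(lra))). tauto. }
    enough (HR : RPinf d T Ti x (plim p snd)) by (specialize (Hx _ HR); lra).
    apply RPinf_closed. intros e He.
    destruct (mem_ex p _ (mem_and p _ _ (Hp e He) (tends_plim p snd e He)))
      as [[x' y'] [[h1 [h2 _]] h3]].
    exists x', y'. split; [exact h1|split; [now rewrite dist_sym|exact h2]].
Qed.

(** Points with ever smaller fibres accumulate at some [z]. The time [k] bringing [z] near [x0] and
    the modulus [r] at [z] are fixed first; a point near [z] with fibre smaller than [r/2] is then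
    moved by [k], and its fibre with it. *)
Lemma small_fiber_dense c : 0 < c ->
  (forall e, 0 < e -> exists x, forall y, RPinf d T Ti x y -> d x y < e) ->
  dense d (fun x => forall y, RPinf d T Ti x y -> d x y < c).
Proof.
  intros Hc H x0 rho Hrho.
  destruct (beta_decreasing (fun e x => forall y, RPinf d T Ti x y -> d x y < e)) as [p Hp].
  - exact H.
  - intros e e' x He h y Hy. specialize (h y Hy); lra.
  - set (z := plim p (fun x => x)).
    destruct (orbit_dense z x0 (rho/2) ltac:(lra)) as [k Hk].
    set (e := Rmin (rho/2) (c/2)).
    pose proof (Rmin_l (rho/2) (c/2)) as e1. pose proof (Rmin_r (rho/2) (c/2)) as e2.
    fold e in e1, e2. assert (He : 0 < e) by (apply Rmin_pos; lra).
    destruct (it_continuous (Z.of_nat k) z e He) as [r [Hr Hcont]].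
    destruct (mem_ex p _ (mem_and p _ _ (Hp (r/2) ltac:(lra))
      (tends_plim p (fun x => x) (r/2) ltac:(lra)))) as [x [h1 h2]].
    fold z in h2. rewrite dist_sym in h2.
    pose proof (Hcont x ltac:(lra)) as h3.
    exists (it (Z.of_nat k) x). split.
    + intros y Hy. apply (RPinf_it (- Z.of_nat k)) in Hy.
      rewrite <- it_add, Z.add_opp_diag_l in Hy. simpl in Hy. apply h1 in Hy.
      pose proof (dist_tri z x (it (- Z.of_nat k) y)) as h4.
      pose proof (Hcont (it (- Z.of_nat k) y) ltac:(lra)) as h5.
      rewrite <- it_add, Z.add_opp_diag_r in h5. simpl in h5.
      pose proof (dist_tri (it (Z.of_nat k) x) (it (Z.of_nat k) z) y) as h6.
      rewrite (dist_sym (it (Z.of_nat k) x) (it (Z.of_nat k) z)) in h6. lra.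
    + pose proof (dist_tri x0 (it (Z.of_nat k) z) (it (Z.of_nat k) x)) as h4.
      rewrite (dist_sym x0 (it (Z.of_nat k) z)) in h4. lra.
Qed.

(** As [RPinf] is an equivalence relation, points with equal image under [phi_inf] are exactly the
    related ones. If no uniform [delta] exists, fibres of arbitrarily small radius occur, and
    [baire] gives a dense set of points whose fibre is trivial. *)
Lemma fibers_iff_not_almost_one_to_one :
  (exists delta, 0 < delta /\ forall x, exists y, RPinf d T Ti x y /\ d x y >= delta) <->
  ~ almost_one_to_one d (phi_inf d T Ti).
Proof.
  split.
  - intros [delta [Hdelta H]] Ha. destruct Hne as [x0].
    destruct (Ha x0 1 ltac:(lra)) as [x [Hx _]]. destruct (H x) as [y [Hy Hxy]].
    assert (E : y = x).
    { apply Hx. apply set_ext; intros z; split; intros Hz.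
      - exact (RPinf_trans x y z Hy Hz).
      - exact (RPinf_trans y x z (RPinf_sym x y Hy) Hz). }
    rewrite E, dist_self in Hxy; lra.
  - intros N. apply NNPP; intros N'. apply N.
    assert (H : forall e, 0 < e -> exists x, forall y, RPinf d T Ti x y -> d x y < e).
    { intros e He. apply NNPP; intros h. apply N'. exists e; split; [exact He|].
      intros x. apply NNPP; intros h'. apply h. exists x; intros y Hy.
      destruct (Rlt_le_dec (d x y) e) as [h2|h2]; [exact h2|].
      exfalso; apply h'. exists y; split; [exact Hy|lra]. }
    assert (Hk : forall k : nat, 0 < / (INR k + 1)).
    { intros k. apply Rinv_0_lt_compat. pose proof (pos_INR k); lra. }
    intros x0 rho Hrho.
    destruct (baire (fun k x => forall y, RPinf d T Ti x y -> d x y < / (INR k + 1)))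
      with (x := x0) (e := rho) as [x [Hx Hx0]].
    + intros k; apply small_fiber_open.
    + intros k; now apply small_fiber_dense.
    + exact Hrho.
    + exists x; split; [|exact Hx0]. intros x' Hx'.
      assert (HR : RPinf d T Ti x x').
      { change (phi_inf d T Ti x x'). rewrite <- Hx'. apply RPinf_refl. }
      symmetry; apply dist_eq; intros e He.
      destruct (archimed_cor1 e He) as [k [h1 h2]].
      apply Rlt_trans with (1 := Hx k x' HR). apply Rlt_trans with (2 := h1).
      apply lt_0_INR in h2. apply Rinv_lt_contravar; [apply Rmult_lt_0_compat; lra|lra].
Qed.

(** * The sensitivity conditions compared with local separation *)

Lemma strongly_sensitive_of_separated c : 0 < c -> locally_separated c ->
  strongly_sensitive d T F_fip.
Proof.
  intros Hc H. exists (c/2); split; [lra|]. intros U HU [x Hx].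
  destruct (HU x Hx) as [e [He HB]].
  destruct (locally_separated_everywhere c x H x e He) as [y [h1 h2]].
  exists x, y. split; [exact Hx|split; [now apply HB|exact h1]].
Qed.

Lemma block_sensitive_of_separated c : 0 < c -> locally_separated c -> block_ip_sensitive d T.
Proof.
  intros Hc H. exists (c/2); split; [lra|]. intros x U [V [HV [Hx HVU]]] l _.
  destruct (HV x Hx) as [e [He HB]].
  destruct (locally_separated_everywhere c x H x e He) as [y [h1 h2]].
  exists y. split; [now apply HVU, HB|apply h1].
Qed.

Lemma separated_of_strongly_sensitive : strongly_sensitive d T F_fip ->
  exists c, 0 < c /\ locally_separated c.
Proof.
  intros [c [Hc H]]. exists c; split; [exact Hc|]. intros l x e He.
  destruct (H (ball d x e) (ball_open x e)) as [x' [y' [h1 [h2 h3]]]].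
  { exists x; unfold ball; now rewrite dist_self. }
  exists x', y'. split; [exact h1|split; [exact h2|apply h3]].
Qed.

Lemma separated_of_block_sensitive : block_ip_sensitive d T ->
  exists c, 0 < c /\ locally_separated c.
Proof.
  intros [c [Hc H]]. exists c; split; [exact Hc|]. intros l x e He.
  assert (Hx : ball d x e x) by (unfold ball; now rewrite dist_self).
  (* Block sensitivity concerns lengths from 1 on, so [S l] also covers [l = 0]. *)
  destruct (H x (ball d x e)) with (l := S l) as [y [h1 h2]]; [|lia|].
  { exists (ball d x e). split; [apply ball_open|split; auto]. }
  exists x, y. split; [exact Hx|split; [exact h1|now apply fip_pred]].
Qed.

Lemma separated_of_fibers :
  (exists delta, 0 < delta /\ forall x, exists y, RPinf d T Ti x y /\ d x y >= delta) ->
  exists c, 0 < c /\ locally_separated c.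
Proof.
  intros [delta [Hdelta H]]. exists (delta/2); split; [lra|]. intros l x rho Hrho.
  now apply fibers_separate.
Qed.

End Dynamics.

Theorem theorem4p4 (X : Type) (d : X -> X -> R) (T S : X -> X)
  (Hne : inhabited X) (Hd : is_metric d) (Hcpt : compact_space d)
  (HT : continuous_map d T) (HS : continuous_map d S)
  (HST : forall x, S (T x) = x) (HTS : forall x, T (S x) = x)
  (Hmin : minimal d T) :
  (strongly_sensitive d T F_fip <-> block_ip_sensitive d T) /\
  (block_ip_sensitive d T <->
     exists delta, 0 < delta /\ forall x, exists y, RPinf d T S x y /\ d x y >= delta) /\
  ((exists delta, 0 < delta /\ forall x, exists y, RPinf d T S x y /\ d x y >= delta) <->
     ~ almost_one_to_one d (phi_inf d T S)).
Proof.
  assert (strongly_sensitive d T F_fip -> exists c, 0 < c /\ locally_separated d T c)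
    by eauto using separated_of_strongly_sensitive.
  assert (block_ip_sensitive d T -> exists c, 0 < c /\ locally_separated d T c)
    by eauto using separated_of_block_sensitive.
  split; [split|split; [split|]].
  - intros h. destruct (H h) as [c [Hc Hl]].
    eapply block_sensitive_of_separated; eauto.
  - intros h. destruct (H0 h) as [c [Hc Hl]].
    eapply strongly_sensitive_of_separated; eauto.
  - intros h. destruct (H0 h) as [c [Hc Hl]]. exists (c/4); split; [lra|].
    intros x. eapply locally_separated_fibers; eauto.
  - intros h. destruct (separated_of_fibers d T S Hne Hd Hcpt HT HS HST HTS Hmin h)
      as [c [Hc Hl]].
    eapply block_sensitive_of_separated; eauto.
  - apply fibers_iff_not_almost_one_to_one; assumption.
Qed.
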